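(* If $G\to F$ is an isometric homomorphism between finitely generated free groups, then the image of $G$ is self-commensurating in $F$.
   Context: Stable commutator length: for a group $G$ and $g\in[G,G]$, $\mathrm{cl}(g)$ is the least number of commutators in $G$ whose product is $g$. For elements $g_1,\dots,g_m\in G$ whose product lies in $[G,G]$, $\mathrm{cl}(\sum g_i)$ is the minimum of $\mathrm{cl}\left(\prod_i h_ig_ih_i^{-1}\right)$ over all $h_i\in G$, and $\mathrm{scl}(\sum g_i)=\lim_{n\to\infty}\mathrm{cl}(\sum g_i^n)/n$. Let $B_1(G)$ be the real vector space of real group $1$-boundaries (finite formal real linear combinations of elements of $G$ that are trivial in $H_1(G;\mathbb R)$). The function $\mathrm{scl}$ extends to a pseudo-norm on $B_1(G)$ which vanishes on the subspace $H$ spanned by all $g^n-ng$ and all $g-hgh^{-1}$, hence descends to $B_1^H(G):=B_1(G)/H$. A homomorphism $\varphi:G\to K$ is isometric if $\mathrm{scl}_G(\Gamma)=\mathrm{scl}_K(\varphi(\Gamma))$ for all $\Gamma\in B_1^H(G)$. A finitely generated subgroup $G<F$ is self-commensurating in $F$ if there is no finitely generated subgroup $E<F$ containing $G$ as a proper subgroup of finite index.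
   Formalization: The case where G is infinite cyclic is excluded: there B_1^H(G)=0, so every homomorphism is isometric, and e.g. Z → Z, 1 ↦ 2, has image that is not self-commensurating. *)

(* Defs.v *)
From HB Require Import structures.
From mathcomp Require Import all_boot all_order all_algebra.
From mathcomp Require Import all_classical reals topology normedtype sequences.
From mathcomp.multinomials Require Import freeg.

Set Implicit Arguments.
Unset Strict Implicit.
Unset Printing Implicit Defensive.

Import Order.TTheory GRing.Theory Num.Theory.
Import numFieldNormedType.Exports.

Local Open Scope classical_set_scope.
Local Open Scope group_scope.

(* Between groups, a morphism of unitary magmas is a group homomorphism. *)
Notation group_hom G K := (UMagmaMorphism.type G K).

Section Subgroups.
Variable G : groupType.

Definition is_subgroup (A : set G) : Prop :=
  [/\ A 1, (forall x y, A x -> A y -> A (x * y)) & (forall x, A x -> A x^-1)].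

Definition subgroup_generated (S : set G) : set G := smallest is_subgroup S.

Definition fg_subgroup (A : set G) : Prop :=
  exists2 S : set G, finite_set S & A = subgroup_generated S.

Definition derived_subgroup : set G :=
  subgroup_generated [set [~ x, y] | x in [set: G] & y in [set: G]].

Definition left_coset (x : G) (A : set G) : set G := [set x * a | a in A].

Definition finite_index (A E : set G) : Prop :=
  finite_set [set left_coset x A | x in E].

Definition self_commensurating (A : set G) : Prop :=
  fg_subgroup A /\
  ~ exists E : set G, [/\ fg_subgroup E, A `<` E & finite_index A E].

Definition free_basis (I : Type) (x : I -> G) : Prop :=
  forall (K : groupType) (y : I -> K),
    exists2 f : group_hom G K, (forall i, f (x i) = y i) &
      forall f' : group_hom G K,
        (forall i, f' (x i) = y i) -> f' =1 f.

Definition free_of_rank (n : nat) : Prop :=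
  exists x : 'I_n -> G, free_basis x.

End Subgroups.

Section CommutatorLength.
Variable G : groupType.

(* Junk value 0 when A is empty. *)
Definition least (A : set nat) : nat := xget 0%N (A `&` lbound A).

Definition is_commutator_product (g : G) (k : nat) : Prop :=
  exists2 s : seq (G * G), size s = k & g = \prod_(p <- s) [~ p.1, p.2].

Definition cl (g : G) : nat := least [set k | is_commutator_product g k].

(* cl (g_1 + ... + g_m) for the sequence gs = [:: g_1; ...; g_m]: each pair
   p = (h_i, g_i) of the sequence s contributes the conjugate of g_i by h_i. *)
Definition cl_sum (gs : seq G) : nat :=
  least [set cl (\prod_(p <- s) (p.1 * p.2 * p.1^-1)) |
         s in [set s : seq (G * G) | unzip2 s = gs]].

End CommutatorLength.

Local Open Scope ring_scope.

Section Scl.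
Variables (R : realType) (G : groupType).

Definition scl_sum (gs : seq G) : R :=
  limn (fun n => (cl_sum [seq (g ^+ n)%g | g <- gs])%:R / n%:R : R).

(* Finite formal real linear combinations of elements of G. *)
Local Notation chain := {freeg G / R}.

Definition chain_of (gs : seq G) : chain := \sum_(g <- gs) << g >>.

Definition is_subspace (V : set chain) : Prop :=
  V 0 /\ forall (a : R) (u v : chain), V u -> V v -> V (a *: u + v).

Definition subspace_spanned (S : set chain) : set chain :=
  smallest is_subspace S.

(* The image of the boundary of the bar complex, (g, h) |-> g + h - gh: the
   chains that are trivial in H_1(G; R). *)
Definition B1 : set chain :=
  subspace_spanned
    [set << x >> + << y >> - << (x * y)%g >> | x in [set: G] & y in [set: G]].

Definition H_relations : set chain :=
  [set c | exists (g : G) (n : nat), c = << (g ^+ n)%g >> - n%:R *: << g >>]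
  `|` [set c | exists (g : G) (n : nat), c = << (g ^- n)%g >> + n%:R *: << g >>]
  `|` [set c | exists g h : G, c = << g >> - << (h * g * h^-1)%g >>].

Definition H_subspace : set chain := subspace_spanned H_relations.

Definition extends_scl (N : chain -> R) : Prop :=
  [/\ [/\ (forall u, B1 u -> 0 <= N u),
          (forall a u, B1 u -> N (a *: u) = `|a| * N u) &
          (forall u v, B1 u -> B1 v -> N (u + v) <= N u + N v)],
      (forall u, H_subspace u -> N u = 0) &
      (forall gs : seq G, derived_subgroup (\prod_(g <- gs) g)%g ->
         N (chain_of gs) = scl_sum gs)].

(* The pseudo-norm extending scl_sum.  Its values on B1 are determined by
   extends_scl: modulo H_subspace an integral 1-boundary is some chain_of gs,
   homogeneity gives the rational ones, and seminorms on finite-dimensional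
   spaces are continuous. Outside of B1 the value is irrelevant. *)
Definition scl : chain -> R := xget (fun=> 0) extends_scl.

End Scl.

Definition chain_map (R : realType) (G K : groupType) (phi : G -> K) :
    {freeg G / R} -> {freeg K / R} :=
  fglift (fun g => << phi g >>).

(* scl is constant on the classes modulo H_subspace, so a class of
   B1 / H_subspace is given by any of its representatives in B1.
   Pitfall: when G is infinite cyclic, B1 = H_subspace, so every homomorphism
   out of G is isometric, e.g. the one from the integers to <a> given by
   1 |-> a ^+ 2; its image is not self-commensurating. *)
Definition isometric (R : realType) (G K : groupType) (phi : G -> K) : Prop :=
  forall c : {freeg G / R}, B1 c -> scl c = scl (chain_map phi c).

(* Main.v *)
(* Suppose that the image A of phi has finite index in E, and let e be in E but
   not in A.  Let x1, x2 be two letters of a basis of G.  Some powers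
   a = x1 ^+ p and b = x2 ^+ q are conjugated by e back into A, say
   e phi(a) e^-1 = phi(a') and e phi(b) e^-1 = phi(b').  Any chain of G that is
   sent by phi to a combination of terms f - h f h^-1 has scl zero, hence is
   killed by all homogenized counting quasimorphisms (easy half of Bavard
   duality).  Testing the chain
     [a^k b] - k[a] - [b] - ([a'^k b'] - k[a'] - [b'])
   against a long power of a^k b for k large shows that a'^k b' is conjugate to
   a^k b.  Hence a - a', b - b' and ab - a'b' are boundaries, and the same test
   shows that a', b', a'b' are conjugate to a, b, ab.  As x1 and x2 are distinct
   letters, this forces a' = g a g^-1 and b' = g b g^-1 for a single g.  Then
   phi(g)^-1 e commutes with phi(a) and phi(b); a power of it is phi(z) with z
   commuting with a and b, so z = 1, and since F is torsion-free e = phi(g).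

   That the hypothesis has content requires the seminorm scl to exist on
   B1 G.  It is obtained as the infimum of sum_j |a_j| scl(gs_j) over the
   decompositions u = sum_j a_j gs_j into integral chains; that this infimum is
   scl(gs) for u = gs reduces, by simultaneous Diophantine approximation of the
   coefficients a_j, to an identity between integral chains. *)

Require Import Defs.
From HB Require Import structures.
From mathcomp Require Import all_boot all_order all_algebra.
From mathcomp Require Import all_classical reals topology normedtype sequences.
From mathcomp.multinomials Require Import freeg.
From mathcomp Require Import zify ring lra.

Set Implicit Arguments.
Unset Strict Implicit.
Unset Printing Implicit Defensive.

Import Order.TTheory GRing.Theory Num.Theory.
Import numFieldNormedType.Exports.

(** * Reduced words *)

Section Words.
(* The letter (t, true) stands for the inverse of (t, false). *)
Variable T : choiceType.
Implicit Types (a b : T * bool) (u v w c d : seq (T * bool)).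

Definition linv a : T * bool := (a.1, ~~ a.2).
Definition no_cancel a b := b != linv a.
Definition reduced w := sorted no_cancel w.
Definition winv w := rev (map linv w).
Definition wstep a w :=
  if w is b :: w' then if b == linv a then w' else a :: w else [:: a].
Definition wmul u v := foldr wstep v u.
Definition wpow c k := flatten (nseq k c).
Definition cyclically_reduced c := reduced (c ++ c).

Lemma linvK : involutive linv.
Proof. by case=> x s; rewrite /linv /= negbK. Qed.

Lemma linv_neq a : linv a != a.
Proof. by case: a => x []; rewrite /linv xpair_eqE /= andbF. Qed.

Lemma no_cancel_linv a b : no_cancel (linv b) (linv a) = no_cancel a b.
Proof. by rewrite /no_cancel (can_eq linvK) eq_sym (can2_eq linvK linvK). Qed.

Lemma winvK : involutive winv.
Proof. by move=> w; rewrite /winv map_rev revK mapK //; exact: linvK. Qed.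

Lemma winv_cat u v : winv (u ++ v) = winv v ++ winv u.
Proof. by rewrite /winv map_cat rev_cat. Qed.

Lemma winv_cons a u : winv (a :: u) = winv u ++ [:: linv a].
Proof. by rewrite -cat1s winv_cat. Qed.

Lemma size_winv w : size (winv w) = size w.
Proof. by rewrite size_rev size_map. Qed.

Lemma reduced_catl u v : reduced (u ++ v) -> reduced u.
Proof. by rewrite /reduced; case: u => //= a u; rewrite cat_path => /andP[]. Qed.

Lemma reduced_catr u v : reduced (u ++ v) -> reduced v.
Proof.
rewrite /reduced; case: u => //= a u; rewrite cat_path => /andP[_].
exact: path_sorted.
Qed.

Lemma reduced_winv w : reduced w -> reduced (winv w).
Proof.
rewrite /reduced /winv rev_sorted sorted_map.
by apply: sub_sorted => a b; rewrite /relpre /= no_cancel_linv.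
Qed.

Lemma reduced_wstep a w : reduced w -> reduced (wstep a w).
Proof.
case: w => [|b w] //= rw; case: eqVneq => [_|ne]; first exact: path_sorted rw.
by rewrite /reduced /= /no_cancel ne.
Qed.

Lemma wstepK a w : reduced w -> wstep (linv a) (wstep a w) = w.
Proof.
case: w => [_|b w /= rw] /=; first by rewrite linvK eqxx.
case: eqVneq => [ba|ne] /=; last by rewrite linvK eqxx.
case: w rw => [|c w] /=; rewrite ba //.
by rewrite /no_cancel linvK => /andP[/negPf ->].
Qed.

Lemma wstepVK a w : reduced w -> wstep a (wstep (linv a) w) = w.
Proof. by move=> rw; rewrite -{1}[a]linvK wstepK. Qed.

Lemma reduced_wmul u v : reduced v -> reduced (wmul u v).
Proof. by move=> rv; elim: u => //= a u; exact: reduced_wstep. Qed.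

Lemma wmul_wstep a v w : reduced w -> wmul (wstep a v) w = wstep a (wmul v w).
Proof.
move=> rw; case: v => //= b v; case: eqVneq => //= ->.
by rewrite wstepVK // reduced_wmul.
Qed.

Lemma wmulA u v w : reduced w -> wmul u (wmul v w) = wmul (wmul u v) w.
Proof. by move=> rw; elim: u => //= a u ->; rewrite wmul_wstep. Qed.

Lemma wmul_cat u v : reduced (u ++ v) -> wmul u v = u ++ v.
Proof.
elim: u => //= a u IHu ruv; rewrite IHu; last exact: path_sorted ruv.
by case: (u ++ v) ruv => //= b w /andP[/negPf ->].
Qed.

Lemma wmulw1 w : reduced w -> wmul w [::] = w.
Proof. by move=> rw; rewrite wmul_cat cats0. Qed.

Lemma wmulKw u v : reduced v -> wmul (winv u) (wmul u v) = v.
Proof.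
move=> rv; elim: u => //= a u IHu.
by rewrite winv_cons /wmul foldr_cat /= wstepK ?reduced_wmul.
Qed.

Lemma wmulVw w : reduced w -> wmul (winv w) w = [::].
Proof. by move=> rw; rewrite -[X in wmul _ X]wmulw1 // wmulKw. Qed.

(** All cancellation happens in one block [z] at the junction. Length and counting estimates for
    products come from cutting the words along [x], [z], [y]. *)
Lemma wmulP u v : reduced u ->
  exists x z y, [/\ u = x ++ z, v = winv z ++ y & wmul u v = x ++ y].
Proof.
elim: u => [|a u IHu] ru; first by exists [::], [::], v.
have [|x [z [y [xz -> /= ->]]]] := IHu; first exact: path_sorted ru.
case: x xz => [|b x] xz.
  case: y => [|c y] /=; first by exists [:: a], z, [::]; rewrite xz.
  case: eqVneq => [->|_]; last by exists [:: a], z, (c :: y); rewrite xz.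
  by exists [::], (a :: z), y; rewrite xz winv_cons -catA.
exists (a :: b :: x), z, y; split=> //; first by rewrite xz.
by move: ru; rewrite xz /= => /andP[/negPf ->].
Qed.

(** Peel off the first and last letters as long as they are mutually inverse. *)
Lemma cyclic_reduction u : reduced u ->
  exists p c, u = p ++ c ++ winv p /\ cyclically_reduced c.
Proof.
have [k] := ubnP (size u); elim: k u => // k IHk [|a u] /=; first by exists [::], [::].
case/lastP: u => [_ _|u b].
  exists [::], [:: a]; split=> //.
  by rewrite /cyclically_reduced /reduced /= /no_cancel eq_sym linv_neq.
rewrite size_rcons => uk ru; have [ba|ne] := eqVneq b (linv a); last first.
  exists [::], (a :: rcons u b); rewrite cats0; split=> //.
  rewrite /cyclically_reduced /reduced /= cat_path; rewrite /reduced /= in ru.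
  by rewrite ru /= last_rcons ru andbT /no_cancel -(inj_eq (can_inj linvK)) linvK eq_sym.
have /IHk[|p [c [-> cc]]] : size u < k by lia.
  by move: ru; rewrite /reduced /= rcons_path => /andP[/path_sorted].
by exists (a :: p), c; split=> //; rewrite winv_cons ba -cats1 /= -!catA.
Qed.

Lemma wpowS c k : wpow c k.+1 = c ++ wpow c k.
Proof. by []. Qed.

Lemma wpowSr c k : wpow c k.+1 = wpow c k ++ c.
Proof.
elim: k => [|k IHk]; first by rewrite /wpow /= cats0.
by rewrite [LHS]wpowS {1}IHk catA -wpowS.
Qed.

Lemma size_wpow c k : size (wpow c k) = k * size c.
Proof. by elim: k => // k IHk; rewrite wpowS size_cat IHk mulSn. Qed.

Lemma winv_wpow c k : winv (wpow c k) = wpow (winv c) k.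
Proof. by elim: k => // k IHk; rewrite wpowSr winv_cat IHk. Qed.

Lemma reduced_wpow c k : cyclically_reduced c -> reduced (wpow c k).
Proof.
case: c => [|a c]; first by move=> _; elim: k.
rewrite /cyclically_reduced /reduced /= cat_path => /andP[ac cc].
have rk l : path no_cancel (last a c) (wpow (a :: c) l).
  by elim: l => // l IHl; rewrite wpowS cat_path cc /=.
by case: k => // k; rewrite wpowS /= cat_path ac rk.
Qed.

Lemma cyclically_reduced_winv c : cyclically_reduced c -> cyclically_reduced (winv c).
Proof. by rewrite /cyclically_reduced -winv_cat; exact: reduced_winv. Qed.

(* Overlapping occurrences are all counted. *)
Fixpoint occurrences w u :=
  if u is _ :: u' then prefix w u + occurrences w u' else 0.

Lemma occurrences_cons w a u :
  occurrences w (a :: u) = prefix w (a :: u) + occurrences w u.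
Proof. by []. Qed.

Lemma occurrencesE w u :
  occurrences w u = count (fun i => prefix w (drop i u)) (iota 0 (size u)).
Proof.
elim: u => // a u; rewrite occurrences_cons => ->.
by rewrite /= (iotaDl 1) count_map.
Qed.

Lemma occurrences_cat_le w u v :
  occurrences w (u ++ v) <= size u + occurrences w v.
Proof.
elim: u => // a u IHu; rewrite cat_cons occurrences_cons /=.
by rewrite addSn -add1n leq_add ?leq_b1.
Qed.

(** Cutting loses only the occurrences of [w] that straddle the junction, and these start at one of
    at most [size w] positions at the end of [u]. *)
Lemma occurrences_cat w u v :
  occurrences w u + occurrences w v <= occurrences w (u ++ v)
    <= occurrences w u + occurrences w v + size w.
Proof.
elim: u => [|a u IHu]; first by rewrite /= leqnn leq_addr.
rewrite cat_cons !occurrences_cons; apply/andP; split.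
  rewrite -addnA leq_add //; last by case/andP: IHu.
  case pw: (prefix w (a :: u)); last by [].
  by rewrite -cat_cons (prefix_trans pw) ?prefix_prefix.
have [szw|szw] := leqP (size w) (size (a :: u)); last first.
  have := occurrences_cat_le w (a :: u) v; rewrite cat_cons occurrences_cons.
  by lia.
have -> : prefix w (a :: u ++ v) = prefix w (a :: u).
  by rewrite -cat_cons !prefixE takel_cat.
by rewrite -!addnA leq_add2l addnA; case/andP: IHu.
Qed.

(** * Periodic words *)

Section Cyclic.
Variable x0 : T * bool.

Definition cyc c i := nth x0 c (i %% size c).

Definition occurs w c i := all (fun j => nth x0 w j == cyc c (i + j)) (iota 0 (size w)).

(** Counted per period of the infinite word c c c ..., so [w] may be longer than [c] and wrap around
    several times. *)
Definition cyclic_occurrences w c := count (occurs w c) (iota 0 (size c)).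

Lemma cycD c k i : cyc c (k * size c + i) = cyc c i.
Proof. by rewrite /cyc modnMDl. Qed.

Lemma cyc_small c i : i < size c -> cyc c i = nth x0 c i.
Proof. by move=> ic; rewrite /cyc modn_small. Qed.

Lemma nth_wpow c k i : i < k * size c -> nth x0 (wpow c k) i = cyc c i.
Proof.
elim: k i => [|k IHk] i; first by rewrite mul0n.
rewrite mulSn => ik; rewrite wpowS nth_cat; case: ltnP => [ic|ci].
  by rewrite cyc_small.
rewrite IHk; last by lia.
by rewrite -(cycD c 1) mul1n subnKC.
Qed.

Lemma occursP w c i :
  reflect (forall j, j < size w -> nth x0 w j = cyc c (i + j)) (occurs w c i).
Proof.
apply: (iffP allP) => [h j jw|h j]; first by apply/eqP/h; rewrite mem_iota.
by rewrite mem_iota => /andP[_ jw]; apply/eqP/h.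
Qed.

Lemma occurs_mod w c k i : occurs w c (k * size c + i) = occurs w c i.
Proof. by apply: eq_all => j; rewrite -addnA cycD. Qed.

Lemma prefix_drop_wpow w c k i : i < k * size c ->
  prefix w (drop i (wpow c k)) = occurs w c i && (i + size w <= k * size c).
Proof.
move=> ik; apply/idP/andP => [|[/occursP ocw iw]].
  move=> /prefixP[v dv].
  have szw : i + size w <= k * size c.
    have : size (drop i (wpow c k)) = size w + size v by rewrite dv size_cat.
    by rewrite size_drop size_wpow; lia.
  split=> //; apply/occursP => j jw.
  rewrite -(@nth_wpow _ k); last by apply: leq_trans szw; rewrite ltn_add2l.
  by rewrite -nth_drop dv nth_cat jw.
have wsz : size w <= size (drop i (wpow c k)).
  by rewrite size_drop size_wpow leq_subRL // ltnW.
rewrite prefixE; apply/eqP/(@eq_from_nth _ x0) => [|j]; rewrite size_takel //.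
move=> jw; rewrite nth_take // nth_drop nth_wpow ?ocw //.
by apply: leq_trans iw; rewrite ltn_add2l.
Qed.

Lemma mul_cyclic_occurrences w c k :
  k * cyclic_occurrences w c = count (occurs w c) (iota 0 (k * size c)).
Proof.
elim: k => [|k IHk]; first by rewrite mul0n.
rewrite mulSn IHk mulSn addnC [size c + _]addnC iotaD count_cat; congr (_ + _).
rewrite add0n -[in RHS](addn0 (k * size c)) iotaDl count_map.
by apply: eq_count => i /=; rewrite occurs_mod.
Qed.

(** The two counts differ only where [w] would run past the end of [wpow c k], at no more than
    [size w] starting positions. Thus [cyclic_occurrences] is the growth rate of the counts along
    powers. *)
Lemma occurrences_wpow w c k :
  occurrences w (wpow c k) <= k * cyclic_occurrences w c
    <= occurrences w (wpow c k) + size w.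
Proof.
rewrite mul_cyclic_occurrences occurrencesE size_wpow.
set N := k * size c.
have -> : count (fun i => prefix w (drop i (wpow c k))) (iota 0 N) =
          count (fun i => occurs w c i && (i + size w <= N)) (iota 0 N).
  by apply: eq_in_count => i; rewrite mem_iota => /prefix_drop_wpow ->.
apply/andP; split; first by apply: sub_count => i /andP[].
have [wN|Nw] := leqP (size w) N; last first.
  by apply: leq_trans (count_size _ _) _; rewrite size_iota; lia.
rewrite -(subnK wN) iotaD !count_cat -addnA leq_add //.
  apply/eq_leq/eq_in_count => i; rewrite mem_iota => iN.
  by rewrite (_ : i + _ <= _) ?andbT //; lia.
apply: leq_trans (leq_addl _ _); apply: leq_trans (count_size _ _) _.
by rewrite size_iota.
Qed.

Definition cyc_prefix d N := mkseq (cyc d) N.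

(** Both infinite words have period [size c * size d], so agreement over that many letters
    propagates to all positions. *)
Lemma cyc_eq_of_occurs c d N i : size c * size d <= N ->
  0 < size c -> 0 < size d ->
  occurs (cyc_prefix d N) c i -> forall j, cyc c (i + j) = cyc d j.
Proof.
move=> Ncd c0 d0 /occursP; rewrite size_mkseq => ocd j.
pose j' := j %% (size c * size d).
have j'N : j' < N by apply: leq_trans Ncd; rewrite ltn_mod muln_gt0 c0.
have := ocd _ j'N; rewrite nth_mkseq //.
rewrite [j](divn_eq _ (size c * size d)) -/j'; move: (j %/ _) => q.
rewrite mulnA cycD => ->.
by rewrite mulnAC addnCA cycD.
Qed.

Lemma cyc_winv d i : i < size d -> cyc (winv d) i = linv (cyc d (size d - i.+1)).
Proof.
move=> id; rewrite cyc_small ?size_winv // cyc_small; last by lia.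
rewrite /winv nth_rev ?size_map // (nth_map x0) //; lia.
Qed.

(* If d were a shift of its inverse, the induced matching of its letters,
   i + j <-> -1 - j modulo the size, would fix a letter or swap two neighbours. *)
Lemma cyclic_occurrences_winv d N : cyclically_reduced d -> 0 < size d ->
  size d * size d <= N -> cyclic_occurrences (cyc_prefix d N) (winv d) = 0.
Proof.
move=> cd d0 Nd; apply/eqP; rewrite -leqn0 leqNgt -has_count; apply/hasPn => i.
rewrite mem_iota size_winv add0n => /andP[_ id]; apply/negP.
move=> /cyc_eq_of_occurs; rewrite size_winv => /(_ Nd d0 d0) h.
set m := size d in d0 Nd id h.
have nc j : no_cancel (cyc d j) (cyc d j.+1).
  have jm : j.+1 < j.+2 * m by exact: leq_pmulr.
  have : reduced (wpow d j.+2) by exact: reduced_wpow.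
  by move=> /(sortedP x0) /(_ j); rewrite size_wpow !nth_wpow ?(ltnW jm) //; exact.
(* Position [i + j] of the periodic inverse word carries the inverse of the letter of [d] at
   [2m - (i + j) - 1]. With [j] at the midpoint this index is [j] or [j.+1]: a letter would be its
   own inverse, or two neighbours would cancel. *)
pose j := (m.*2 - i.+1)./2.
have jE : j.*2 = m.*2 - i.+1 \/ j.*2.+1 = m.*2 - i.+1.
  have := odd_double_half (m.*2 - i.+1); rewrite -/j.
  by case: odd => /=; [right|left]; lia.
have hj : cyc (winv d) (i + j) = linv (cyc d (m.*2 - (i + j).+1)).
  have [ijm|mij] := ltnP (i + j) m.
    rewrite cyc_winv // -(cycD d 1) -/m; congr (linv (cyc _ _)); lia.
  rewrite (_ : i + j = 1 * size (winv d) + (i + j - m)); last first.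
    by rewrite size_winv -/m; lia.
  rewrite cycD cyc_winv -/m; last by lia.
  by congr (linv (cyc _ _)); rewrite size_winv -/m; lia.
rewrite h in hj; case: jE => jE.
  move: hj; have -> : m.*2 - (i + j).+1 = j by lia.
  by move/eqP; rewrite eq_sym (negPf (linv_neq _)).
have := nc j; rewrite /no_cancel hj (_ : m.*2 - (i + j).+1 = j.+1); last by lia.
by rewrite linvK eqxx.
Qed.

(** For nonempty [d] this says that [d] is not a proper power; the form through shifts is the one
    that occurrences deliver. *)
Definition primitive d := forall i, i < size d ->
  (forall j, cyc d (i + j) = cyc d j) -> i = 0.

Lemma cyclic_occurrences_gt0 d N : 0 < size d ->
  0 < cyclic_occurrences (cyc_prefix d N) d.
Proof.
move=> d0; rewrite -has_count; apply/hasP; exists 0; first by rewrite mem_iota.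
by apply/occursP => j; rewrite size_mkseq => jN; rewrite nth_mkseq.
Qed.

Lemma cyclic_occurrences_primitive d N : 0 < size d -> primitive d ->
  size d * size d <= N -> cyclic_occurrences (cyc_prefix d N) d = 1.
Proof.
move=> d0 pd Nd; apply/eqP; rewrite eqn_leq cyclic_occurrences_gt0 // andbT.
rewrite /cyclic_occurrences (@eq_in_count _ _ (pred1 0)) ?count_uniq_mem ?iota_uniq //.
  by case: (_ \in _).
move=> i; rewrite mem_iota => /andP[_ id] /=; apply/idP/eqP => [|->].
  by move=> /cyc_eq_of_occurs h; apply: pd => // j; rewrite h.
by apply/occursP => j; rewrite size_mkseq => jN; rewrite nth_mkseq.
Qed.

Lemma rot_of_cyclic_occurrences c d N : 0 < size d -> primitive d ->
  size c * size d <= N -> 0 < cyclic_occurrences (cyc_prefix d N) c ->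
  exists i k, [/\ 0 < k, i <= size c & rot i c = wpow d k].
Proof.
move=> d0 pd Ncd; rewrite -has_count => /hasP[i]; rewrite mem_iota => /andP[_ ic].
rewrite add0n in ic; have c0 : 0 < size c by exact: leq_ltn_trans ic.
move=> /cyc_eq_of_occurs h.
have {}h j : cyc c (i + j) = cyc d j by exact: h.
(* [size c] is a period of the infinite word of [d], hence so is its remainder modulo [size d],
   which vanishes by primitivity. *)
have dc : size d %| size c.
  apply/eqP; apply: pd; first by rewrite ltn_mod.
  move=> j; rewrite -[RHS]h -(cycD c 1) mul1n addnCA h.
  by rewrite [in RHS](divn_eq (size c) (size d)) -addnA cycD.
exists i, (size c %/ size d); split; first by rewrite divn_gt0 // dvdn_leq.
  exact: ltnW.
apply: (@eq_from_nth _ x0) => [|j]; first by rewrite size_rot size_wpow divnK.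
rewrite size_rot => jc; rewrite nth_wpow ?divnK // -h /rot nth_cat size_drop.
rewrite /cyc; case: ltnP => ij; first by rewrite nth_drop modn_small //; lia.
rewrite nth_take; last by lia.
have -> : i + j = 1 * size c + (j - (size c - i)) by lia.
rewrite modnMDl modn_small //; lia.
Qed.

Lemma primitive1 a : primitive [:: a].
Proof. by case. Qed.

(** A shift by [i] that preserves the periodic word starts at a letter [a], so [i < p]; if [i] were
    positive, the final [b] would be matched with the [a] at position [i - 1]. *)
Lemma primitive2 a b p q : a != b -> 0 < p -> 0 < q ->
  primitive (nseq p a ++ nseq q b).
Proof.
move=> ab p0 q0 i; rewrite size_cat !size_nseq => ipq h.
have nthE k : k < p + q -> cyc (nseq p a ++ nseq q b) k = if k < p then a else b.
  move=> kpq; rewrite cyc_small ?size_cat ?size_nseq // nth_cat size_nseq.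
  by case: ltnP => kp; rewrite nth_nseq ?kp // (_ : k - p < q) //; lia.
have := h 0; rewrite addn0 !nthE ?p0 //; last by lia.
case: ltnP => [ip _|_ ba]; last by rewrite ba eqxx in ab.
case: i ip ipq h => // i ip ipq /(_ (p + q).-1).
rewrite [RHS]nthE ?ifN; [|by lia..].
have -> : i.+1 + (p + q).-1 = 1 * size (nseq p a ++ nseq q b) + i.
  by rewrite size_cat !size_nseq; lia.
rewrite cycD nthE ?ifT; [|by lia..].
by move=> ba; rewrite ba eqxx in ab.
Qed.

End Cyclic.
End Words.

Local Open Scope group_scope.

(** * Homogenized counting quasimorphisms *)

Section Quasimorphisms.
Variable G : groupType.
Implicit Types (g h x y : G) (f : G -> int) (s : int) (k m : nat).

Definition conjugate x y := exists h, y = h * x * h^-1.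

Lemma conjugate_refl x : conjugate x x.
Proof. by exists 1; rewrite mul1g invg1 mulg1. Qed.

Lemma conjugate_sym x y : conjugate x y -> conjugate y x.
Proof. by case=> h ->; exists h^-1; rewrite invgK !mulgA mulVg mul1g mulgVK. Qed.

Lemma conjugate_trans x y z : conjugate x y -> conjugate y z -> conjugate x z.
Proof. by case=> h -> [k ->]; exists (k * h); rewrite invgM !mulgA. Qed.

Lemma conjugateV x y : conjugate x y -> conjugate x^-1 y^-1.
Proof. by case=> h ->; exists h; rewrite !invgM invgK mulgA. Qed.

Lemma conjM h x y : h * (x * y) * h^-1 = (h * x * h^-1) * (h * y * h^-1).
Proof. by rewrite !mulgA mulgVK. Qed.

Lemma conjX h x k : (h * x * h^-1) ^+ k = h * x ^+ k * h^-1.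
Proof.
elim: k => [|k IHk]; first by rewrite !expg0 mulg1 mulgV.
by rewrite !expgS IHk conjM.
Qed.

Definition odd_quasimorphism f (D : nat) :=
  (forall x, f (x^-1)%g = - f x)%R /\
  forall x y, (`|f (x * y)%g - f x - f y| <= D%:Z)%R.

(** The homogenization of [f] at [g]. For counting functions it is an integer reached up to a
    bounded error, so no limit has to be taken. *)
Definition is_slope f g s :=
  exists B : nat, forall k, (`|f (g ^+ k)%g - s * k%:Z| <= B%:Z)%R.

Definition slope f g : int := xget 0%R [set s | is_slope f g s]%classic.

Lemma is_slope_uniq f g s s' : is_slope f g s -> is_slope f g s' -> s = s'.
Proof.
case=> B hB [B' hB']; have := hB (B + B').+1; have := hB' (B + B').+1.
move: (f _) => z; nia.
Qed.

Lemma slopeE f g s : is_slope f g s -> slope f g = s.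
Proof.
move=> fs; apply: is_slope_uniq (fs).
by apply: (@xgetPex _ 0%R [set z | is_slope f g z]%classic); exists s.
Qed.

Section Odd.
Variables (f : G -> int) (D : nat).
Hypothesis qf : odd_quasimorphism f D.

Lemma qm_conj h g : (`|f (h * g * h^-1)%g - f g| <= (D + D)%:Z)%R.
Proof.
case: qf => fV fM; have := fM (h * g) h^-1; have := fM h g; rewrite fV.
by move: (f _) (f _) (f _) (f _) => *; lia.
Qed.

Lemma is_slope_conj h g s : is_slope f g s -> is_slope f (h * g * h^-1) s.
Proof.
case=> B hB; exists (B + (D + D)) => k; have := hB k; have := qm_conj h (g ^+ k).
rewrite conjX; move: (f _) (f _) => *; lia.
Qed.

Lemma is_slopeX g s m : is_slope f g s -> is_slope f (g ^+ m) (s * m%:Z)%R.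
Proof. by case=> B hB; exists B => k; rewrite -expgnA -mulrA -PoszM. Qed.

Lemma is_slopeV g s : is_slope f g s -> is_slope f g^-1 (- s)%R.
Proof.
case=> B hB; exists B => k; have := hB k; case: qf => fV _.
rewrite expVgn fV; move: (f _) => *; lia.
Qed.

End Odd.
End Quasimorphisms.

(** * Normal forms in a free group *)

Section Coordinates.
Variables (G : groupType) (T : choiceType) (rw : G -> seq (T * bool)).
Implicit Types (c d g h x y : G) (u v w : seq (T * bool)).

(** An isomorphism onto the group of reduced words, given as a map to bare sequences so that the
    word lemmas apply directly. *)
Definition coordinates := [/\ injective rw, forall g, reduced (rw g),
  forall g h, rw (g * h) = wmul (rw g) (rw h) &
  forall w, reduced w -> exists g, rw g = w].

Hypothesis rwP : coordinates.

Lemma rw_inj : injective rw. Proof. by case: rwP. Qed.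
Lemma rw_reduced g : reduced (rw g). Proof. by case: rwP. Qed.
Lemma rwM g h : rw (g * h) = wmul (rw g) (rw h). Proof. by case: rwP. Qed.
Lemma rw_surj w : reduced w -> exists g, rw g = w. Proof. by case: rwP => ? ? ? /(_ w). Qed.

Lemma rw1 : rw 1 = [::].
Proof.
have [g gE] : exists g, rw g = [::] by exact: rw_surj.
by have := rwM g 1; rewrite mulg1 gE.
Qed.

Lemma rw_eq1 g : rw g = [::] -> g = 1.
Proof. by rewrite -rw1; exact: rw_inj. Qed.

Lemma rwV g : rw g^-1 = winv (rw g).
Proof.
have [h hE] : exists h, rw h = winv (rw g).
  by apply: rw_surj; apply: reduced_winv; exact: rw_reduced.
suff -> : g^-1 = h by [].
apply: (mulIg g); rewrite mulVg; apply: rw_inj.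
by rewrite rwM hE rw1 wmulVw // rw_reduced.
Qed.

Lemma rwM_cat g h : reduced (rw g ++ rw h) -> rw (g * h) = rw g ++ rw h.
Proof. by move=> ?; rewrite rwM wmul_cat. Qed.

Lemma rw_split g u v : rw g = u ++ v ->
  exists x y, [/\ g = x * y, rw x = u & rw y = v].
Proof.
move=> gE; have ruv : reduced (u ++ v) by rewrite -gE rw_reduced.
have [x xE] := rw_surj (reduced_catl ruv).
have [y yE] := rw_surj (reduced_catr ruv).
by exists x, y; split=> //; apply: rw_inj; rewrite rwM_cat xE yE.
Qed.

Lemma rwX g k : cyclically_reduced (rw g) -> rw (g ^+ k) = wpow (rw g) k.
Proof.
move=> cg; elim: k => [|k IHk]; first by rewrite expg0 rw1.
by rewrite expgS rwM IHk wpowS wmul_cat // -wpowS reduced_wpow.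
Qed.

Lemma size_rwM g h : size (rw (g * h)) <= size (rw g) + size (rw h).
Proof.
rewrite rwM; have [x [z [y [-> -> ->]]]] := wmulP (rw h) (rw_reduced g).
rewrite !size_cat; lia.
Qed.

Lemma cyclic_reductionG g :
  exists h c, g = h * c * h^-1 /\ cyclically_reduced (rw c).
Proof.
have [p [r [gE cr]]] := cyclic_reduction (rw_reduced g).
have [h [x [-> hp]]] := rw_split gE.
move=> /rw_split[y [z [-> yr zp]]].
exists h, y; split; last by rewrite yr.
suff -> : z = h^-1 by rewrite mulgA.
by apply: rw_inj; rewrite rwV zp hp.
Qed.

Lemma size_rw_conj_le g h :
  size (rw (h * g * h^-1)) <= size (rw g) + (size (rw h)).*2.
Proof.
have := size_rwM (h * g) h^-1; have := size_rwM h g.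
by rewrite rwV size_winv; lia.
Qed.

(** Passing to [k]-th powers multiplies both lengths by [k], while the conjugator adds at most twice
    its own length; a large [k] gives the inequality. *)
Lemma size_cyclically_reduced_le x y : conjugate x y ->
  cyclically_reduced (rw x) -> cyclically_reduced (rw y) ->
  size (rw y) <= size (rw x).
Proof.
case=> h yE cx cy; rewrite leqNgt; apply/negP => xy.
set k := (size (rw h)).*2.+1.
have := size_rw_conj_le (x ^+ k) h; rewrite -conjX -yE !rwX // !size_wpow.
rewrite /k; nia.
Qed.

Lemma size_cyclically_reduced x y : conjugate x y ->
  cyclically_reduced (rw x) -> cyclically_reduced (rw y) ->
  size (rw y) = size (rw x).
Proof.
move=> xy cx cy; apply/eqP; rewrite eqn_leq !size_cyclically_reduced_le //.
exact: conjugate_sym.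
Qed.

Lemma torsion_free g k : g ^+ k = 1 -> 0 < k -> g = 1.
Proof.
have [h [c [-> cc]]] := cyclic_reductionG g.
rewrite conjX => ck k0.
suff /rw_eq1 -> : rw c = [::] by rewrite mulg1 mulgV.
have : conjugate (c ^+ k) 1 by exists h.
move=> /conjugate_sym[e]; rewrite mulg1 mulgV => /(congr1 rw).
rewrite rw1 rwX // => /(congr1 size); rewrite size_wpow => /eqP.
by rewrite muln_eq0 size_eq0 => /orP[/eqP k00|/eqP]//; rewrite k00 in k0.
Qed.

Definition brooks w g : int :=
  ((occurrences w (rw g))%:Z - (occurrences w (rw (g^-1)%g))%:Z)%R.

(** With [x = u z], [y = z^-1 v] and [x y = u v], the counts in [u], [v], [z] and their inverses
    cancel. Each of the three values of [brooks w] leaves a junction error of absolute value at most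
    [size w]. *)
Lemma brooks_qm w : odd_quasimorphism (brooks w) (3 * size w).
Proof.
split=> [x|x y]; first by rewrite /brooks invgK opprB.
rewrite /brooks !rwV rwM.
have [u [z [v [-> -> ->]]]] := wmulP (rw y) (rw_reduced x).
rewrite !winv_cat winvK.
have := occurrences_cat w u v; have := occurrences_cat w u z.
have := occurrences_cat w (winv v) (winv u).
have := occurrences_cat w (winv z) v; have := occurrences_cat w (winv z) (winv u).
have := occurrences_cat w (winv v) z.
lia.
Qed.

Variable x0 : T * bool.

Lemma brooks_is_slope w c : cyclically_reduced (rw c) ->
  is_slope (brooks w) c ((cyclic_occurrences x0 w (rw c))%:Z -
                         (cyclic_occurrences x0 w (rw (c^-1)%g))%:Z)%R.
Proof.
move=> cc; exists (size w) => k; rewrite /brooks !rwV rwX // winv_wpow.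
have := occurrences_wpow x0 w (rw c) k.
have := occurrences_wpow x0 w (winv (rw c)) k.
lia.
Qed.

Lemma slope_brooksP w g : is_slope (brooks w) g (slope (brooks w) g).
Proof.
have [h [c [-> cc]]] := cyclic_reductionG g.
have := is_slope_conj (brooks_qm w) h (brooks_is_slope w cc).
by move=> s; rewrite (slopeE s).
Qed.

Lemma slope_conj w x y : conjugate x y -> slope (brooks w) y = slope (brooks w) x.
Proof.
case=> h ->; apply: slopeE.
exact: (is_slope_conj (brooks_qm w)) (slope_brooksP w x).
Qed.

Lemma slopeX w g m : slope (brooks w) (g ^+ m) = (slope (brooks w) g * m%:Z)%R.
Proof. by apply: slopeE; apply: is_slopeX (slope_brooksP w g). Qed.

Lemma slopeV w g : slope (brooks w) g^-1 = (- slope (brooks w) g)%R.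
Proof. by apply: slopeE; apply: (is_slopeV (brooks_qm w)) (slope_brooksP w g). Qed.

(** After cyclic reduction to [c], a prefix of c c c ... as long as the square of the period occurs
    cyclically in [c] but never in its inverse, so its slope is positive. *)
Lemma slope_neq0 g : g <> 1 -> exists w, slope (brooks w) g <> 0%R.
Proof.
have [h [c [-> cc]]] := cyclic_reductionG g => hc.
have c0 : 0 < size (rw c).
  rewrite lt0n size_eq0; apply/eqP => /rw_eq1 c1.
  by apply: hc; rewrite c1 mulg1 mulgV.
pose w := cyc_prefix x0 (rw c) (size (rw c) * size (rw c)).
exists w; rewrite (@slope_conj w c); last by exists h.
rewrite (slopeE (brooks_is_slope w cc)) rwV (cyclic_occurrences_winv x0 cc) //.
have := cyclic_occurrences_gt0 x0 (size (rw c) * size (rw c)) c0.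
rewrite -/w; lia.
Qed.

(* The test word is a long prefix of d d d ...: as soon as it is longer than the
   product of the two periods, an occurrence in c c c ... forces the two
   periodic words to agree up to a shift. *)
Lemma primitive_test d (l : seq G) : 0 < size (rw d) ->
  cyclically_reduced (rw d) -> primitive x0 (rw d) ->
  exists w, slope (brooks w) d = 1%R /\ forall g, g \in l ->
    slope (brooks w) g = 0%R \/ exists2 k, 0 < k &
      conjugate (d ^+ k) g \/ conjugate (d ^- k) g.
Proof.
move=> d0 cd pd.
have /boolp.choice[core coreP] g :
    exists c, conjugate c g /\ cyclically_reduced (rw c).
  by have [h [c [-> cc]]] := cyclic_reductionG g; exists c; split=> //; exists h.
(* One length serves all tests: [N] dominates the products of periods needed for [d] and for the
   cyclically reduced representative of each element of [l]. *)
pose N := \sum_(g <- d :: l) (size (rw g) + size (rw (core g))) * size (rw d).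
have leN g : g \in d :: l -> (size (rw g) + size (rw (core g))) * size (rw d) <= N.
  by move=> gl; rewrite /N (big_rem g) //= leq_addr.
(* An occurrence makes a rotation of [rw g] a power of [rw d], and rotating the word is conjugating
   [g] by its tail [y]. *)
have shift (c : nat) g : c * size (rw d) <= N -> cyclically_reduced (rw g) ->
    c = size (rw g) -> 0 < cyclic_occurrences x0 (cyc_prefix x0 (rw d) N) (rw g) ->
    exists2 k, 0 < k & conjugate (d ^+ k) g.
  move=> cN cg cE /(rot_of_cyclic_occurrences d0 pd); rewrite -cE => /(_ cN).
  case=> i [k [k0 _ rotE]]; exists k => //; apply: conjugate_sym.
  have := esym (cat_take_drop i (rw g)) => /rw_split[x [y [gE xE yE]]].
  have yx : rw y ++ rw x = wpow (rw d) k by rewrite xE yE.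
  exists y; rewrite gE !mulgA mulgK; apply: rw_inj; rewrite rwX // -yx rwM_cat //.
  by rewrite yx reduced_wpow.
exists (cyc_prefix x0 (rw d) N); split=> [|g gl].
  rewrite (slopeE (brooks_is_slope _ cd)) rwV.
  have dN : size (rw d) * size (rw d) <= N.
    have := leN d (mem_head _ _); lia.
  by rewrite cyclic_occurrences_winv ?cyclic_occurrences_primitive.
have [cg ccg] := coreP g.
have cN : size (rw (core g)) * size (rw d) <= N.
  have := leN g; rewrite inE gl orbT => /(_ isT); lia.
rewrite (slope_conj _ cg) (slopeE (brooks_is_slope _ ccg)).
have [c1|c1] := posnP (cyclic_occurrences x0 (cyc_prefix x0 (rw d) N) (rw (core g))).
  have [c2|c2] := posnP (cyclic_occurrences x0 (cyc_prefix x0 (rw d) N) (rw (core g)^-1)).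
    by left; rewrite c1 c2.
  have [||k k0 dk] := @shift _ _ cN _ _ c2; rewrite ?rwV ?size_winv //.
    exact: cyclically_reduced_winv.
  right; exists k => //; right; apply: conjugate_trans cg.
  by rewrite -[core g]invgK; exact: conjugateV.
have [k k0 dk] := @shift _ _ cN ccg erefl c1.
by right; exists k => //; left; apply: conjugate_trans dk cg.
Qed.

End Coordinates.

(** * Powers of two basis elements *)

Section Letters.
Variables (G : groupType) (T : choiceType) (rw : G -> seq (T * bool)).
Hypothesis rwP : coordinates rw.
Implicit Types (g h x y z : G) (a b : T * bool) (u v w : seq (T * bool)).

Lemma reduced_cat a u v : reduced u -> reduced v ->
  (last a u).1 != (head a v).1 -> reduced (u ++ v).
Proof.
case: u => [|c u] //; case: v => [|b v]; rewrite ?cats0 // /reduced /= cat_path.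
move=> -> /= -> uv; rewrite andbT /no_cancel.
by apply: contra uv => /eqP ->.
Qed.

Lemma strip_left (P : pred (T * bool)) a u :
  exists v w, [/\ u = v ++ w, all P v & w != [::] -> ~~ P (head a w)].
Proof.
elim: u => [|b u [v [w [-> Pv Pw]]]]; first by exists [::], [::].
case Pb: (P b); first by exists (b :: v), w; split=> //=; rewrite Pb.
by exists [::], (b :: v ++ w); split=> //= _; rewrite Pb.
Qed.

Lemma strip_right (P : pred (T * bool)) a u :
  exists v w, [/\ u = v ++ w, all P w & v != [::] -> ~~ P (last a v)].
Proof.
have [v [w [uE Pv Pw]]] := strip_left P a (rev u).
exists (rev w), (rev v); rewrite -rev_cat -uE revK all_rev; split=> //.
by case: w {uE} Pw => // b w; rewrite rev_cons last_rcons => Pw _; exact: Pw.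
Qed.

Lemma reduced_nseq a k : reduced (nseq k a).
Proof.
rewrite /reduced; case: k => //= k; elim: k => //= k ->.
by rewrite /no_cancel eq_sym linv_neq.
Qed.

Lemma cyclically_reduced_nseq a k : cyclically_reduced (nseq k a).
Proof. by rewrite /cyclically_reduced -nseqD reduced_nseq. Qed.

Lemma rwX_letter x a k : rw x = [:: a] -> rw (x ^+ k) = nseq k a.
Proof.
move=> xE; rewrite (rwX rwP) xE; last exact: (cyclically_reduced_nseq a 1).
by elim: k => // k IHk; rewrite wpowS IHk.
Qed.

Lemma last_nseq a b k : 0 < k -> last a (nseq k b) = b.
Proof. by case: k => // k _; elim: k => //= k; case: k. Qed.

Lemma head_nseq a b k : 0 < k -> head a (nseq k b) = b.
Proof. by case: k. Qed.

Lemma last_winv a u : u != [::] -> last a (winv u) = linv (head a u).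
Proof. by case: u => // b u _; rewrite winv_cons last_cat. Qed.

Lemma head_winv a u : u != [::] -> head a (winv u) = linv (last a u).
Proof.
by case/lastP: u => // u b _; rewrite -cats1 winv_cat last_cat.
Qed.

Lemma commute_letters x a y : rw x = [:: a] ->
  all (fun b => b.1 == a.1) (rw y) -> commute y x.
Proof.
move=> xE; have [k] := ubnP (size (rw y)); elim: k y => // k IHk y.
case yE: (rw y) => [|b w] /=.
  by move=> _ _; rewrite (rw_eq1 rwP yE); exact/commute_sym/commute1.
move=> wk /andP[ba aw].
have [z [t [-> zE tE]]] := rw_split rwP (yE : rw y = [:: b] ++ w).
apply/commute_sym/commuteM; last by apply/commute_sym/IHk; rewrite tE.
suff [->|->] : z = x \/ z = x^-1.
  - exact: commute_refl.
  - exact/commuteV/commute_refl.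
have [ab|ab] := eqVneq b a; first by left; apply: (rw_inj rwP); rewrite zE ab xE.
right; apply: (rw_inj rwP); rewrite zE (rwV rwP) xE; congr (_ :: _).
move: ab ba; rewrite {}/linv; case: (a) (b) => [i s] [j r] /= jr /eqP ji.
by move: jr; rewrite ji xpair_eqE eqxx /=; case: r s => [] [].
Qed.

(** Split off from [z] its longest suffix [t] in the letter of [x1], which commutes with [x1 ^+ p].
    The rest [y] then commutes with it too, but [y * x1 ^+ p * y^-1] is reduced as written, hence
    too long unless [y] is trivial. *)
Lemma commute_letter_pow x1 a1 z p : rw x1 = [:: a1] -> 0 < p -> commute z (x1 ^+ p) ->
  all (fun b => b.1 == a1.1) (rw z).
Proof.
move=> x1E p0 zx; have [v [w [zE aw hv]]] := strip_right (fun b => b.1 == a1.1) a1 (rw z).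
have [v0|v0] := eqVneq v [::]; first by rewrite zE v0.
have [y [t [ztE yE tE]]] := rw_split rwP zE.
have tx : commute t (x1 ^+ p) by apply/commuteX/(commute_letters x1E); rewrite tE.
have : y * x1 ^+ p * y^-1 = x1 ^+ p.
  move: zx; rewrite /commute ztE -[y * t * _]mulgA tx => zx.
  by apply: (mulIg (y * t)); rewrite !mulgA mulgVK -!mulgA zx mulgA.
move=> /(congr1 (fun g => size (rw g))).
have yr : reduced (rw y ++ rw (x1 ^+ p) ++ rw y^-1).
  apply: (@reduced_cat a1); first exact: (rw_reduced rwP).
    apply: (@reduced_cat a1); rewrite ?(rw_reduced rwP) //.
    rewrite (rwX_letter _ x1E) last_nseq // (rwV rwP) yE head_winv //.
    by rewrite eq_sym; exact: hv.
  rewrite (rwX_letter _ x1E) yE.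
  by case: p p0 {zx tx} => // p _; exact: hv.
have e := rwM_cat rwP (reduced_catr yr); rewrite -e in yr.
rewrite -mulgA (rwM_cat rwP yr) e (rwV rwP) (rwX_letter _ x1E).
rewrite !size_cat size_nseq yE; case: v v0 {zE hv yE yr} => // b v _ /=; lia.
Qed.

Variables (x1 x2 : G) (a1 a2 : T * bool).
Hypotheses (x1E : rw x1 = [:: a1]) (x2E : rw x2 = [:: a2]) (a12 : a1.1 != a2.1).

Lemma rw_pow2 p q : 0 < p -> 0 < q ->
  rw (x1 ^+ p * x2 ^+ q) = nseq p a1 ++ nseq q a2.
Proof.
move=> p0 q0; rewrite (rwM_cat rwP) !(rwX_letter _ x1E, rwX_letter _ x2E) //.
by apply: (@reduced_cat a1); rewrite ?reduced_nseq ?last_nseq ?head_nseq.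
Qed.

Lemma cyclically_reduced_pow2 p q : 0 < p -> 0 < q ->
  cyclically_reduced (nseq p a1 ++ nseq q a2).
Proof.
move=> p0 q0; have r12 : reduced (nseq p a1 ++ nseq q a2).
  by apply: (@reduced_cat a1); rewrite ?reduced_nseq ?last_nseq ?head_nseq.
apply: (@reduced_cat a1) => //; case: p p0 {r12} => // p _ /=.
by rewrite last_cat last_nseq // eq_sym.
Qed.

Lemma commute_pow_eq1 z p q : 0 < p -> 0 < q ->
  commute z (x1 ^+ p) -> commute z (x2 ^+ q) -> z = 1.
Proof.
move=> p0 q0 /(commute_letter_pow x1E p0) z1.
move=> /(commute_letter_pow x2E q0) z2; apply: (rw_eq1 rwP).
by case: (rw z) z1 z2 => //= b w /andP[/eqP -> _] /andP[/eqP /eqP]; rewrite (negPf a12).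
Qed.

(** Strip from [z = h^-1 * k] its longest prefix [S] in the letter of [x1], then the longest suffix
    [U] in the letter of [x2], leaving [V]. If [V] is trivial, [h * S] conjugates both elements.
    Otherwise [Y] is cyclically reduced of length [p + q] plus twice the length of [V], yet
    conjugate to a cyclically reduced element of length [p + q]. *)
Lemma simultaneous_conjugate p q y1 y2 : 0 < p -> 0 < q ->
  conjugate (x1 ^+ p) y1 -> conjugate (x2 ^+ q) y2 ->
  conjugate (x1 ^+ p * x2 ^+ q) (y1 * y2) ->
  exists g, y1 = g * x1 ^+ p * g^-1 /\ y2 = g * x2 ^+ q * g^-1.
Proof.
move=> p0 q0 [h ->] [k ->] conj12; set z := h^-1 * k.
have kE : k = h * z by rewrite mulgA mulgV mul1g.
have [s [r [zE as1 hr]]] := strip_left (fun b => b.1 == a1.1) a1 (rw z).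
have [w [t [rE at2 hw]]] := strip_right (fun b => b.1 == a2.1) a2 r.
have [S [R [SRE SE RE]]] := rw_split rwP zE.
rewrite rE in RE; have [V [U [VUE VE UE]]] := rw_split rwP RE.
have Sx : S * x1 ^+ p * S^-1 = x1 ^+ p.
  have /(commuteX p) -> : commute S x1 by apply: (commute_letters x1E); rewrite SE.
  by rewrite mulgK.
have Ux : U * x2 ^+ q * U^-1 = x2 ^+ q.
  have /(commuteX q) -> : commute U x2 by apply: (commute_letters x2E); rewrite UE.
  by rewrite mulgK.
have [w0|w0] := eqVneq w [::].
  exists (h * S); rewrite kE SRE VUE (rw_eq1 rwP (etrans VE w0)) mul1g.
  split; first by rewrite -{1}Sx !invgM !mulgA.
  by rewrite -{2}Ux !invgM !mulgA.
exfalso; have hw2 := hw w0; have hw1 : (head a1 w).1 != a1.1.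
  by case: w w0 {hw hw2 RE VE} rE => // b w _ rE; move: hr; rewrite rE; exact.
have p1E := rwX_letter p x1E; have q2E := rwX_letter q x2E.
have a1w b : head b w = head a1 w by case: (w) w0.
have a2w b : last b w = last a2 w by case: (w) w0.
set Y := x1 ^+ p * (V * (x2 ^+ q * V^-1)).
have iw0 : winv w != [::] by rewrite -size_eq0 size_winv size_eq0.
have r1 : reduced (rw (x2 ^+ q) ++ rw V^-1).
  apply: (@reduced_cat a1); rewrite ?(rw_reduced rwP) //.
  rewrite q2E last_nseq // (rwV rwP) VE head_winv // a2w.
  by rewrite eq_sym.
have r2 : reduced (rw V ++ rw (x2 ^+ q) ++ rw V^-1).
  apply: (@reduced_cat a1); rewrite ?(rw_reduced rwP) //.
  rewrite q2E VE a2w; case: (q) q0 => //.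
have YE : rw Y = nseq p a1 ++ w ++ nseq q a2 ++ winv w.
  have r3 : reduced (rw (x1 ^+ p) ++ rw V ++ rw (x2 ^+ q) ++ rw V^-1).
    apply: (@reduced_cat a1); rewrite ?(rw_reduced rwP) //.
    rewrite p1E last_nseq // VE; case: (w) w0 hw1 => //= b ? _.
    by rewrite eq_sym.
  rewrite -(rwM_cat rwP r1) in r2 r3; rewrite -(rwM_cat rwP r2) in r3.
  rewrite /Y (rwM_cat rwP r3) (rwM_cat rwP r2) (rwM_cat rwP r1).
  by rewrite (rwV rwP) p1E q2E VE.
have cY : cyclically_reduced (rw Y).
  apply: (@reduced_cat a1); rewrite ?(rw_reduced rwP) //.
  rewrite YE !last_cat last_winv ?a1w //.
  by case: (p) p0.
have : conjugate (x1 ^+ p * x2 ^+ q) Y.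
  apply: conjugate_trans conj12 _.
  have -> : k * x2 ^+ q * k^-1 = h * S * (V * (x2 ^+ q * V^-1)) * (h * S)^-1.
    by rewrite kE SRE VUE -{2}Ux !invgM !mulgA.
  have -> : h * x1 ^+ p * h^-1 = h * S * x1 ^+ p * (h * S)^-1.
    by rewrite -{1}Sx !invgM !mulgA.
  by rewrite -conjM; apply: conjugate_sym; exists (h * S).
move=> /(size_cyclically_reduced rwP); rewrite (rw_pow2) //.
move=> /(_ (cyclically_reduced_pow2 p0 q0) cY).
rewrite YE !size_cat; case: (w) w0 => // b ? _ /=; lia.
Qed.

End Letters.

(** * Free groups *)

Section FreeWords.
Variable T : choiceType.

(** The concrete free group: a target for the universal property in [free_basis], from which normal
    forms are read off. *)
Record freeword := FreeWord { fw_val :> seq (T * bool); fw_reduced : reduced fw_val }.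

HB.instance Definition _ := [isSub for fw_val].
HB.instance Definition _ := [Choice of freeword by <:].

Definition fw_one := @FreeWord [::] isT.
Definition fw_mul (u v : freeword) := FreeWord (reduced_wmul u (fw_reduced v)).
Definition fw_inv (u : freeword) := FreeWord (reduced_winv (fw_reduced u)).

Lemma fw_mulA : associative fw_mul.
Proof. by move=> u v w; apply: val_inj; apply: wmulA; exact: fw_reduced. Qed.

Lemma fw_mul1 : left_id fw_one fw_mul.
Proof. by move=> u; apply: val_inj. Qed.

Lemma fw_mulr1 : right_id fw_one fw_mul.
Proof. by move=> u; apply: val_inj; apply: wmulw1; exact: fw_reduced. Qed.

Lemma fw_mulV : left_inverse fw_one fw_inv fw_mul.
Proof. by move=> u; apply: val_inj; apply: wmulVw; exact: fw_reduced. Qed.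

Lemma fw_mulrV : right_inverse fw_one fw_inv fw_mul.
Proof.
move=> u; apply: val_inj => /=; rewrite -[X in wmul X _]winvK.
by apply: wmulVw; apply: reduced_winv; exact: fw_reduced.
Qed.

HB.instance Definition _ :=
  isGroup.Build freeword fw_mulA fw_mul1 fw_mulr1 fw_mulV fw_mulrV.

Definition fw_letter (a : T * bool) : freeword := @FreeWord [:: a] isT.

End FreeWords.

Section Evaluation.
Variables (T : choiceType) (G : groupType) (x : T -> G).

Definition eval_letter (a : T * bool) := if a.2 then (x a.1)^-1 else x a.1.
Definition eval_word (w : seq (T * bool)) := \prod_(a <- w) eval_letter a.
Definition fw_eval (w : freeword T) := eval_word w.

Lemma eval_wstep a w : eval_word (wstep a w) = eval_letter a * eval_word w.
Proof.
case: w => [|b w] /=; first by rewrite /eval_word big_seq1 big_nil mulg1.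
case: eqVneq => [->|_]; last by rewrite /eval_word big_cons.
rewrite /eval_word big_cons mulgA /eval_letter /=.
by case: a.2; rewrite /= ?mulgV ?mulVg mul1g.
Qed.

Lemma eval_wmul u v : eval_word (wmul u v) = eval_word u * eval_word v.
Proof.
elim: u => [|a u IHu]; first by rewrite /eval_word big_nil mul1g.
by rewrite /= eval_wstep IHu mulgA /eval_word big_cons.
Qed.

Lemma fw_evalM : {morph fw_eval : u v / u * v}.
Proof. by move=> u v; exact: eval_wmul. Qed.

Lemma fw_eval1 : fw_eval 1 = 1.
Proof. by rewrite /fw_eval /eval_word big_nil. Qed.

HB.instance Definition _ := isMultiplicative.Build (freeword T) G fw_eval fw_evalM.
HB.instance Definition _ :=
  Multiplicative_isUMagmaMorphism.Build (freeword T) G fw_eval fw_eval1.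

End Evaluation.

(** The universal property maps [G] to reduced words, and evaluation is the inverse: one composite
    is the identity by uniqueness of lifts, the other is computed letter by letter. *)
Lemma free_basis_coordinates (G : groupType) (T : choiceType) (x : T -> G) :
  free_basis x -> exists2 rw : G -> seq (T * bool),
    coordinates rw & forall i, rw (x i) = [:: (i, false)].
Proof.
move=> fx; have [f fE _] := fx (freeword T) (fun i => fw_letter (i, false)).
pose e : group_hom (freeword T) G := fw_eval x.
have fK : cancel f e.
  have [f0 _ uniq0] := fx G x.
  have u1 := uniq0 (e \o f : group_hom G G); have u2 := uniq0 (idfun : group_hom G G).
  move=> g; rewrite -[RHS]/(idfun g) u2 // -u1 //= => i.
  by rewrite fE /= /fw_eval /eval_word big_seq1.
have eK : cancel e f.
  move=> w; rewrite /e /= /fw_eval /eval_word gmulf_prod.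
  apply: val_inj; case: w => w /= rw; elim: w rw => [|a w IHw] rw; first by rewrite big_nil.
  rewrite big_cons /= {}IHw; last exact: path_sorted rw.
  have -> : val (f (eval_letter x a)) = [:: a].
    case: a {rw} => i [] /=; rewrite /eval_letter /= ?gmulfV fE //.
  by case: w rw => //= b w /andP[/negPf ->].
exists (fun g => val (f g)); last by move=> i; rewrite fE.
split=> [g h /val_inj /(can_inj fK)//|g|g h|w rw].
- exact: fw_reduced.
- by rewrite gmulfM.
- by exists (e (FreeWord rw)); rewrite eK.
Qed.

Lemma subgroup_generatedS (G : groupType) (S A : set G) : is_subgroup A ->
  (S `<=` A)%classic -> (subgroup_generated S `<=` A)%classic.
Proof. by move=> sA SA g; apply. Qed.

Lemma free_basis_generates (G : groupType) (T : choiceType) (x : T -> G) :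
  free_basis x -> forall A : set G, is_subgroup A -> (forall i, A (x i)) ->
  forall g, A g.
Proof.
move=> fx A [A1 AM AV] Ax g.
have [rw rwP rwx] := free_basis_coordinates fx.
have [k] := ubnP (size (rw g)); elim: k g => // k IHk g.
case gE: (rw g) => [|a w] /=; first by rewrite (rw_eq1 rwP gE).
have [y [z [-> yE zE]]] := rw_split rwP (gE : rw g = [:: a] ++ w) => wk.
apply: AM; last by apply: IHk; rewrite zE.
case: a {gE} yE => i [] yE; last by rewrite (_ : y = x i) //; apply: (rw_inj rwP); rewrite yE rwx.
have -> : y = (x i)^-1; last exact: AV.
by apply: (rw_inj rwP); rewrite yE (rwV rwP) rwx.
Qed.

(** * Commutator length of chains *)

Lemma leastP (A : set nat) n : A n -> A (least A) /\ forall m, A m -> least A <= m.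
Proof.
move=> An; have exA : exists n, `[< A n >] by exists n; apply/asboolP.
have [m /asboolP Am min_m] := ex_minnP exA.
have : (A `&` lbound A)%classic (least A).
  apply: xgetPex; exists m; split=> // k Ak; rewrite leEnat.
  by apply: min_m; apply/asboolP.
by case=> AA lA; split=> // k /lA; rewrite leEnat.
Qed.

Section Derived.
Variable G : groupType.
Implicit Types (g h x y z : G) (gs hs : seq G).

Local Notation cp := (@is_commutator_product G).
Local Notation D := (@derived_subgroup G).

Lemma cp1 : cp 1 0.
Proof. by exists [::]; rewrite ?big_nil. Qed.

Lemma cpM g h k l : cp g k -> cp h l -> cp (g * h) (k + l).
Proof.
by case=> s <- -> [t <- ->]; exists (s ++ t); rewrite ?size_cat ?big_cat.
Qed.

Lemma cpR x y : cp [~ x, y] 1.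
Proof. by exists [:: (x, y)]; rewrite ?big_seq1. Qed.

Lemma cpV g k : cp g k -> cp g^-1 k.
Proof.
case=> s <- -> {g k}; elim: s => [|p s IHs]; first by rewrite big_nil invg1; exact: cp1.
by rewrite big_cons invgM /= -addn1; apply: cpM => //; rewrite invgR; exact: cpR.
Qed.

Lemma cpJ g h k : cp g k -> cp (h * g * h^-1) k.
Proof.
case=> s <- -> {g k}; elim: s => [|p s IHs].
  by rewrite big_nil mulg1 mulgV; exact: cp1.
rewrite big_cons /= -add1n.
have -> : h * ([~ p.1, p.2] * \prod_(q <- s) [~ q.1, q.2]) * h^-1 =
    [~ p.1 ^ h^-1, p.2 ^ h^-1] * (h * \prod_(q <- s) [~ q.1, q.2] * h^-1).
  by rewrite -conjRg conjgE invgK !mulgA mulgVK.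
by apply: cpM => //; exact: cpR.
Qed.

Lemma derivedP g : D g <-> exists k, cp g k.
Proof.
split.
  move=> /(_ [set x | exists k, cp x k]%classic); apply.
  split=> [|_ [x _ [y _ <-]]]; last by exists 1%N; exact: cpR.
  split=> [|x y [k xk] [l yl]|x [k xk]]; first by exists 0%N; exact: cp1.
  - by exists (k + l)%N; exact: cpM.
  - by exists k; exact: cpV.
case=> k [s _ ->] A [[A1 AM AV] cA].
elim: s => [|p s IHs]; first by rewrite big_nil.
by rewrite big_cons; apply: AM => //; apply: cA; exists p.1 => //; exists p.2.
Qed.

Lemma derived1 : D 1.
Proof. by apply/derivedP; exists 0%N; exact: cp1. Qed.

Lemma derivedM x y : D x -> D y -> D (x * y).
Proof.
move=> /derivedP[k xk] /derivedP[l yl]; apply/derivedP; exists (k + l)%N; exact: cpM.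
Qed.

Lemma derivedV x : D x -> D x^-1.
Proof. by move=> /derivedP[k xk]; apply/derivedP; exists k; exact: cpV. Qed.

Lemma derivedJ h x : D x -> D (h * x * h^-1).
Proof. by move=> /derivedP[k xk]; apply/derivedP; exists k; exact: cpJ. Qed.

Lemma derivedR x y : D [~ x, y].
Proof. by apply/derivedP; exists 1%N; exact: cpR. Qed.

(** Equality in the abelianization. *)
Definition ab_eq x y := D (x * y^-1).

Lemma ab_eq_refl x : ab_eq x x.
Proof. by rewrite /ab_eq mulgV; exact: derived1. Qed.

Lemma ab_eq_sym x y : ab_eq x y -> ab_eq y x.
Proof. by move=> /derivedV; rewrite /ab_eq invgM invgK. Qed.

Lemma ab_eq_trans x y z : ab_eq x y -> ab_eq y z -> ab_eq x z.
Proof. by move=> xy /(derivedM xy); rewrite /ab_eq mulgA mulgVK. Qed.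

Lemma ab_eqC x y : ab_eq (x * y) (y * x).
Proof.
rewrite /ab_eq invgM mulgA.
have -> : x * y * x^-1 * y^-1 = [~ x^-1, y^-1] by rewrite commgEl conjgE !invgK !mulgA.
exact: derivedR.
Qed.

Lemma ab_eqM x x' y y' : ab_eq x x' -> ab_eq y y' -> ab_eq (x * y) (x' * y').
Proof.
rewrite /ab_eq => xx yy; have := derivedM (derivedJ x yy) xx.
by rewrite !mulgA invgM mulgVK !mulgA.
Qed.

Lemma ab_eqV x y : ab_eq x y -> ab_eq x^-1 y^-1.
Proof.
by move=> /derivedV /(derivedJ y^-1); rewrite /ab_eq invgM !invgK !mulgA mulVg mul1g.
Qed.

Lemma ab_eqJ h x : ab_eq (h * x * h^-1) x.
Proof.
by have := ab_eqC (h * x) h^-1; rewrite !mulgA mulVg mul1g.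
Qed.

Definition conjugate_product gs g := exists2 s : seq (G * G),
  unzip2 s = gs & g = \prod_(p <- s) (p.1 * p.2 * p.1^-1).

Local Notation cjp := conjugate_product.

Lemma cjp_nil : cjp [::] 1.
Proof. by exists [::]; rewrite ?big_nil. Qed.

Lemma cjp_cons h x gs g : cjp gs g -> cjp (x :: gs) (h * x * h^-1 * g).
Proof. by case=> s <- ->; exists ((h, x) :: s); rewrite ?big_cons. Qed.

Lemma cjp_consP x gs g : cjp (x :: gs) g ->
  exists h g', cjp gs g' /\ g = h * x * h^-1 * g'.
Proof.
case=> [[|[h y] s]] //= [<- <-] ->; rewrite big_cons /=; exists h.
by exists (\prod_(p <- s) (p.1 * p.2 * p.1^-1)); split=> //; exists s.
Qed.

Lemma cjp_prod gs : cjp gs (\prod_(g <- gs) g).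
Proof.
elim: gs => [|g gs IHgs]; first by rewrite big_nil; exact: cjp_nil.
by rewrite big_cons; have := cjp_cons 1 g IHgs; rewrite mul1g invg1 mulg1.
Qed.

Lemma cjp_ab gs g : cjp gs g -> ab_eq g (\prod_(x <- gs) x).
Proof.
elim: gs g => [|x gs IHgs] g.
  by case=> [[]] // _ ->; rewrite !big_nil; exact: ab_eq_refl.
by case/cjp_consP=> h [y [/IHgs yx ->]]; rewrite big_cons; apply: ab_eqM (ab_eqJ _ _) yx.
Qed.

Lemma cjp_cat gs hs g h : cjp gs g -> cjp hs h -> cjp (gs ++ hs) (g * h).
Proof.
case=> s <- -> [t <- ->]; exists (s ++ t); rewrite ?big_cat //.
by rewrite /unzip2 map_cat.
Qed.

Lemma cjp_catP gs hs g : cjp (gs ++ hs) g ->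
  exists a b, [/\ cjp gs a, cjp hs b & g = a * b].
Proof.
elim: gs g => [|x gs IHgs] g /=.
  by move=> hg; exists 1, g; rewrite mul1g; split=> //; exact: cjp_nil.
case/cjp_consP=> h [g' [/IHgs[a [b [ga hb ->]]] ->]].
exists (h * x * h^-1 * a), b; rewrite !mulgA; split=> //.
exact: cjp_cons.
Qed.

(** A conjugate of [x] moves past [a] at the price of changing its conjugator from [h] to
    [a^-1 * h]. *)
Lemma cjp_perm gs hs g : perm_eq gs hs -> cjp gs g -> cjp hs g.
Proof.
elim: gs hs g => [|x gs IHgs] hs g; first by rewrite perm_sym => /perm_nilP ->.
move=> pgh; have : x \in hs by rewrite -(perm_mem pgh) mem_head.
move=> xhs; case/splitPr: xhs pgh => h1 h2.
rewrite perm_sym -cat1s perm_catCA /= perm_cons perm_sym => pgh.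
case/cjp_consP=> h [g' [/(IHgs _ _ pgh)/cjp_catP[a [b [h1a h2b ->]]] ->]].
have := cjp_cat h1a (cjp_cons (a^-1 * h) x h2b).
by rewrite invgM invgK !mulgA mulgV mul1g.
Qed.

Lemma cjpV gs g : cjp gs g -> cjp [seq x^-1 | x <- gs] g^-1.
Proof.
elim: gs g => [|x gs IHgs] g.
  by case=> [[]] // _ ->; rewrite big_nil invg1; exact: cjp_nil.
case/cjp_consP=> k [g' [/IHgs hg' ->]].
have := cjp_cons (g'^-1 * k) x^-1 hg'.
by rewrite !invgM !invgK !mulgA mulgK.
Qed.

(* [reach gs k] iff [cl_sum gs <= k] when the product of [gs] is in [G, G]. *)
Definition reach gs k := exists2 g, cjp gs g & cp g k.

Lemma ab_eq1 x : ab_eq x 1 <-> D x.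
Proof. by rewrite /ab_eq invg1 mulg1. Qed.

Lemma reach_derived gs k : reach gs k -> D (\prod_(g <- gs) g).
Proof.
case=> g /cjp_ab/ab_eq_sym gP gk; apply: (iffLR (ab_eq1 _)).
by apply: (ab_eq_trans gP); apply: (iffRL (ab_eq1 _)); apply/derivedP; exists k.
Qed.

Lemma cl_sumP gs : D (\prod_(g <- gs) g) ->
  reach gs (cl_sum gs) /\ forall k, reach gs k -> cl_sum gs <= k.
Proof.
move=> dgs; rewrite /cl_sum; set A := (X in least X).
have clP (s : seq (G * G)) : unzip2 s = gs ->
    cp (\prod_(p <- s) (p.1 * p.2 * p.1^-1)) (cl (\prod_(p <- s) (p.1 * p.2 * p.1^-1)))
    /\ forall k, cp (\prod_(p <- s) (p.1 * p.2 * p.1^-1)) k ->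
         cl (\prod_(p <- s) (p.1 * p.2 * p.1^-1)) <= k.
  move=> sgs; set g := \prod_(p <- s) _.
  have /derivedP[k gk] : D g.
    apply: (iffLR (ab_eq1 _)); apply: (ab_eq_trans _ (iffRL (ab_eq1 _) dgs)).
    by apply: cjp_ab; exists s.
  exact: leastP gk.
have [s sgs _] := cjp_prod gs.
have [] := @leastP A _ (imageP _ (sgs : [set s | unzip2 s = gs]%classic s)).
move=> [t tgs <-] Amin; split=> [|k [g [r rgs ->] gk]].
  by have [tcl _] := clP t tgs; eexists; [exists t|exact: tcl].
have [_ rcl] := clP r rgs; apply: leq_trans (rcl _ gk).
by apply: Amin; exists r.
Qed.

Lemma reach_le gs k : reach gs k -> cl_sum gs <= k.
Proof. by move=> gk; have [_] := cl_sumP (reach_derived gk); apply. Qed.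

Lemma reach_cl_sum gs : D (\prod_(g <- gs) g) -> reach gs (cl_sum gs).
Proof. by case/cl_sumP. Qed.

Lemma reach_perm gs hs k : perm_eq gs hs -> reach gs k -> reach hs k.
Proof. by move=> gh [g /(cjp_perm gh)]; exists g. Qed.

Lemma reach_cat gs hs k l : reach gs k -> reach hs l -> reach (gs ++ hs) (k + l).
Proof.
case=> g gP gk [h hP hl]; exists (g * h); [exact: cjp_cat|exact: cpM].
Qed.

Lemma reachV gs k : reach gs k -> reach [seq x^-1 | x <- gs] k.
Proof. by case=> g /cjpV gP /cpV; exists g^-1. Qed.

Lemma reach_prod1 gs : \prod_(g <- gs) g = 1 -> reach gs 0.
Proof. by move=> gs1; exists 1; [rewrite -gs1; exact: cjp_prod|exact: cp1]. Qed.

Lemma reach_cons1 gs k : reach (1 :: gs) k <-> reach gs k.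
Proof.
split=> [[g /cjp_consP[h [g' [gP ->]]]]|[g gP gk]].
  by rewrite mulg1 mulgV mul1g; exists g'.
by exists g => //; have := cjp_cons 1 1 gP; rewrite mulg1 mulgV mul1g.
Qed.

(** The conjugates of [x] and [y] come with different conjugators [h] and [h']; replacing [h'] by
    [h] multiplies the product by a conjugate of one commutator. *)
Lemma reach_merge x y gs k : reach (x :: y :: gs) k -> reach (x * y :: gs) k.+1.
Proof.
case=> g /cjp_consP[h [_ [/cjp_consP[h' [g' [gP ->]]] ->]]] gk.
pose Y := h * y * h^-1; pose c := [~ Y^-1, (h' * h^-1)^-1].
exists (h * (x * y) * h^-1 * g'); first exact: cjp_cons.
have -> : h * (x * y) * h^-1 * g' = (h * x * h^-1) * c * (h * x * h^-1)^-1 *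
    (h * x * h^-1 * (h' * y * h'^-1 * g')).
  rewrite /c /Y commgEl conjgE !invgM !invgK !mulgA; congr (_ * g').
  by rewrite !(mulgVK, mulgK).
by rewrite -add1n; apply: cpM gk; apply: cpJ; exact: cpR.
Qed.

(** Applied to two powers of the same element, which add up, and to mutually inverse elements, which
    cancel; the cost does not depend on the exponents. *)
Lemma reach_merges (T : Type) (p q : T -> G) (s : seq T) hs k :
  reach ([seq p t | t <- s] ++ [seq q t | t <- s] ++ hs) k ->
  reach ([seq p t * q t | t <- s] ++ hs) (k + size s).
Proof.
elim: s hs k => [|t s IHs] hs k /=; first by rewrite addn0.
set ps := map p s; set qs := map q s => pqk.
have /reach_merge mk : reach (p t :: q t :: ps ++ qs ++ hs) k.
  by apply: reach_perm pqk; apply/permP => P; rewrite /= !count_cat /= !count_cat; lia.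
have /IHs sk : reach (ps ++ qs ++ p t * q t :: hs) k.+1.
  by apply: reach_perm mk; apply/permP => P; rewrite /= !count_cat /=; lia.
rewrite addnS -addSn; apply: reach_perm sk.
by apply/permP => P; rewrite /= !count_cat /=; lia.
Qed.

Lemma reach_ones (T : Type) (s : seq T) hs k :
  reach ([seq (1 : G) | _ <- s] ++ hs) k <-> reach hs k.
Proof.
by elim: s => //= x s IHs; split=> [/reach_cons1/IHs|/IHs/reach_cons1].
Qed.

Lemma reach_cancel gs hs k :
  reach (gs ++ [seq x^-1 | x <- gs] ++ hs) k -> reach hs (k + size gs).
Proof.
rewrite -{1}[gs]map_id => /reach_merges.
by rewrite (eq_map (@mulgV G)) => /reach_ones.
Qed.

Definition powers n gs := [seq g ^+ n | g <- gs].

Lemma powers_cat n gs hs : powers n (gs ++ hs) = powers n gs ++ powers n hs.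
Proof. exact: map_cat. Qed.

Lemma size_powers n gs : size (powers n gs) = size gs.
Proof. exact: size_map. Qed.

Lemma reach_powersD m n gs hs k :
  reach (powers m gs ++ powers n gs ++ hs) k ->
  reach (powers (m + n) gs ++ hs) (k + size gs).
Proof.
by move=> /reach_merges; congr (reach (_ ++ _) _); apply: eq_map => x; rewrite expgnDr.
Qed.

Lemma reach_powers0 gs hs k : reach hs k -> reach (powers 0 gs ++ hs) k.
Proof. by move=> /reach_ones; apply. Qed.

Lemma derived_powers n gs : D (\prod_(g <- gs) g) -> D (\prod_(g <- powers n gs) g).
Proof.
move=> /reach_cl_sum; set k := cl_sum gs => gk.
suff [l gl] : exists l, reach (powers n gs) l by exact: reach_derived gl.
elim: n => [|n [l nl]].
  by exists 0%N; have := reach_powers0 gs (reach_prod1 (big_nil _ _ _ _)); rewrite cats0; apply.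
exists (l + k + size gs)%N; have := reach_cat nl gk.
rewrite -addn1 -[powers (n + 1) gs]cats0 => nk; apply: reach_powersD.
by rewrite cats0 /powers (eq_map (@expg1 G)) map_id.
Qed.

Lemma reach_cl_powers n gs : D (\prod_(g <- gs) g) ->
  reach (powers n gs) (cl_sum (powers n gs)).
Proof. by move=> dg; exact: reach_cl_sum (derived_powers n dg). Qed.

Lemma derived_prod_cat gs hs : D (\prod_(g <- gs) g) -> D (\prod_(g <- hs) g) ->
  D (\prod_(g <- gs ++ hs) g).
Proof. by move=> dg dh; rewrite big_cat; exact: derivedM. Qed.

Lemma derived_prod_perm gs hs : perm_eq gs hs ->
  D (\prod_(g <- gs) g) -> D (\prod_(g <- hs) g).
Proof. by move=> gh /reach_cl_sum/(reach_perm gh)/reach_derived. Qed.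

Lemma derived_prod_copies k gs : D (\prod_(g <- gs) g) ->
  D (\prod_(g <- flatten (nseq k gs)) g).
Proof.
move=> dg; elim: k => [|k IHk] /=; last exact: derived_prod_cat.
by rewrite big_nil; exact: derived1.
Qed.

(** Subadditivity up to a constant, the input of Fekete's lemma. *)
Lemma cl_powersD m n gs : D (\prod_(g <- gs) g) ->
  cl_sum (powers (m + n) gs) <= cl_sum (powers m gs) + cl_sum (powers n gs) + size gs.
Proof.
move=> dg; apply: reach_le; rewrite -[powers _ _]cats0; apply: reach_powersD.
by rewrite cats0; apply: reach_cat; exact: reach_cl_powers.
Qed.

Lemma cl_powers_cat n gs hs : D (\prod_(g <- gs) g) -> D (\prod_(g <- hs) g) ->
  cl_sum (powers n (gs ++ hs)) <= cl_sum (powers n gs) + cl_sum (powers n hs).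
Proof.
move=> dg dh; apply: reach_le; rewrite powers_cat.
by apply: reach_cat; exact: reach_cl_powers.
Qed.

Lemma cl_powers_perm n gs hs : perm_eq gs hs -> D (\prod_(g <- gs) g) ->
  cl_sum (powers n hs) <= cl_sum (powers n gs).
Proof.
move=> gh dg; apply: reach_le; apply: reach_perm (perm_map _ gh) _.
exact: reach_cl_powers.
Qed.

(** The [k] copies of each [g ^+ n] are merged into [g ^+ (k * n)]; the cost is independent of [n]
    and disappears in the limit. *)
Lemma cl_powers_copies k n gs : D (\prod_(g <- gs) g) ->
  cl_sum (powers (k * n) gs) <= cl_sum (powers n (flatten (nseq k gs))) + k * size gs.
Proof.
move=> dg; apply: reach_le.
have : reach (powers n (flatten (nseq k gs)) ++ [::])
    (cl_sum (powers n (flatten (nseq k gs)))).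
  by rewrite cats0; apply: reach_cl_powers; exact: derived_prod_copies.
rewrite -[powers (k * n) gs]cats0; move: (cl_sum _) [::] => l hs.
elim: k hs l => [|k IHk] hs l; first by rewrite !mul0n addn0; exact: reach_powers0.
rewrite /= powers_cat -catA => kl; rewrite !mulSn addnA addnAC.
apply: reach_powersD; apply: (@reach_perm (powers (k * n) gs ++ powers n gs ++ hs)).
  by rewrite perm_catCA.
by apply: IHk; apply: reach_perm kl; rewrite perm_catCA.
Qed.

(** Append the inverses of the powers of [hs], which need no more commutators than these powers do,
    and cancel; the cost of cancelling is independent of [n]. *)
Lemma cl_powers_cancel n gs hs : D (\prod_(g <- gs) g) -> D (\prod_(g <- hs) g) ->
  cl_sum (powers n gs) <=
    cl_sum (powers n (gs ++ hs)) + cl_sum (powers n hs) + size hs.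
Proof.
move=> dg dh; apply: reach_le; rewrite -(size_powers n hs); apply: reach_cancel.
have ghk := reach_cl_powers n (derived_prod_cat dg dh).
have hk := reachV (reach_cl_powers n dh).
apply: reach_perm (reach_cat ghk hk); rewrite powers_cat -catA.
by rewrite perm_catC -catA perm_cat2l.
Qed.

Lemma cl_powers_eq0 n gs : \prod_(g <- powers n gs) g = 1 ->
  cl_sum (powers n gs) = 0%N.
Proof. by move=> /reach_prod1/reach_le; rewrite leqn0 => /eqP. Qed.

End Derived.

(** * Existence of the scl seminorm *)

Section Rate.
Local Open Scope classical_set_scope.
Local Open Scope ring_scope.
Variable R : realType.
Implicit Types (u v : nat -> nat) (a b e : R).

(** Convergence of [u n / n] to [a], multiplied out so that estimates need no division by [n]. *)
Definition is_rate u a := forall e, 0 < e ->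
  exists N, forall n, (N <= n)%N -> `|(u n)%:R - a * n%:R| <= e * n%:R.

Lemma nat_ge (a : R) : exists n : nat, a <= n%:R.
Proof. by exists (Num.trunc a).+1; rewrite ltW // truncnS_gt. Qed.

Lemma is_rate_lim u a : is_rate u a -> limn (fun n => (u n)%:R / n%:R : R) = a.
Proof.
move=> ua; apply: cvg_lim => //; apply/cvgrPdist_le => e e0.
have [N hN] := ua e e0; near=> n.
have n0 : 0 < n%:R :> R by rewrite ltr0n; near: n; exact: nbhs_infty_gt.
have -> : a - (u n)%:R / n%:R = - (((u n)%:R - a * n%:R) / n%:R).
  by rewrite mulrBl mulfK ?gt_eqF // opprB.
rewrite normrN normrM normfV (gtr0_norm n0).
rewrite ler_pdivrMr //; apply: hN; near: n; exact: nbhs_infty_ge.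
Unshelve. all: by end_near. Qed.

Lemma is_rate_le u v a b C : is_rate u a -> is_rate v b ->
  (forall n, u n <= v n + C)%N -> a <= b.
Proof.
move=> ua vb uv; apply/ler_addgt0Pr => e e0.
have e30 : 0 < e / 3 by rewrite divr_gt0.
have [N1 h1] := ua _ e30; have [N2 h2] := vb _ e30.
have [m Cm] := nat_ge (C%:R / (e / 3)).
set n := (N1 + N2 + m).+1; have n0 : 0 < n%:R :> R by rewrite ltr0n.
have N1n : (N1 <= n)%N by rewrite /n; lia.
have N2n : (N2 <= n)%N by rewrite /n; lia.
have := h1 n N1n; have := h2 n N2n; rewrite !ler_norml.
move=> /andP[_ vn] /andP[un _].
have Cn : C%:R <= e / 3 * n%:R.
  rewrite mulrC -ler_pdivrMr //; apply: le_trans Cm _; rewrite ler_nat /n; lia.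
have : (u n)%:R <= (v n)%:R + C%:R :> R by rewrite -natrD ler_nat.
move=> uvn; rewrite -(ler_pM2r n0) mulrDl; lra.
Qed.

Lemma is_rateD u v a b : is_rate u a -> is_rate v b ->
  is_rate (fun n => u n + v n)%N (a + b).
Proof.
move=> ua vb e e0; have e20 : 0 < e / 2 by rewrite divr_gt0.
have [N1 h1] := ua _ e20; have [N2 h2] := vb _ e20.
exists (N1 + N2)%N => n Nn; rewrite natrD.
have un : `|(u n)%:R - a * n%:R| <= e / 2 * n%:R by apply: h1; lia.
have vn : `|(v n)%:R - b * n%:R| <= e / 2 * n%:R by apply: h2; lia.
have -> : e * n%:R = e / 2 * n%:R + e / 2 * n%:R by rewrite -mulrDl -splitr.
rewrite [X in `|X|](_ : _ = ((u n)%:R - a * n%:R) + ((v n)%:R - b * n%:R)); last by ring.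
exact: le_trans (ler_normD _ _) (lerD un vn).
Qed.

Lemma is_rateM u a k : (0 < k)%N -> is_rate u a ->
  is_rate (fun n => u (k * n)%N) (k%:R * a).
Proof.
move=> k0 ua e e0; have k0R : 0 < k%:R :> R by rewrite ltr0n.
have [N hN] := ua _ (divr_gt0 e0 k0R); exists N => n Nn.
have := hN (k * n)%N (leq_trans Nn (leq_pmull n k0)).
by rewrite natrM mulrCA !mulrA divfK ?gt_eqF.
Qed.

Lemma is_rate0 : is_rate (fun=> 0%N) 0.
Proof. by move=> e e0; exists 0%N => n _; rewrite mul0r subr0 normr0 mulr_ge0 // ltW. Qed.

Lemma is_rate_ge0 u a : is_rate u a -> 0 <= a.
Proof. by move=> ua; apply: (is_rate_le (C := 0) is_rate0 ua). Qed.

(** Fekete's lemma for the subadditive sequence [u n + C]: the rate is the infimum of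
    [(u n + C) / n] over positive [n]. *)
Lemma fekete_rate u C : (forall m n, u (m + n) <= u m + u n + C)%N ->
  exists a, is_rate u a.
Proof.
move=> uD; pose E : set R := [set (u n + C)%:R / n%:R | n in [set n | 0 < n]%N].
have E_inf : has_inf E.
  split; first by exists ((u 1 + C)%:R / 1%:R); exists 1%N.
  by exists 0 => _ [n _ <-]; rewrite divr_ge0.
exists (inf E) => e e0.
have [_ [m /= m0 <-] em] := inf_adherent (divr_gt0 e0 (ltr0n _ 2)) E_inf.
have m0R : 0 < m%:R :> R by rewrite ltr0n.
(* When [n] is divided by [m], the remainder contributes at most the constant [K]. *)
pose K := (\sum_(r < m) u r)%N.
have ur r : (r < m)%N -> (u r <= K)%N.
  by move=> rm; rewrite /K (bigD1 (Ordinal rm)) //= leq_addr.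
have uq q r : (u (q * m + r) <= q * (u m + C) + u r)%N.
  elim: q => [|q IHq]; first by rewrite !mul0n !add0n.
  by rewrite mulSn -addnA; have := uD m (q * m + r)%N; rewrite mulSn; lia.
have [N1 hN1] := nat_ge (K%:R / (e / 2)); have [N2 hN2] := nat_ge (C%:R / e).
exists (N1 + N2).+1 => n Nn.
have n0R : 0 < n%:R :> R by rewrite ltr0n; lia.
have lo : inf E * n%:R <= (u n + C)%:R.
  rewrite -ler_pdivlMr //; apply: ge_inf; first by case: E_inf.
  by exists n => //=; lia.
have Cn : C%:R <= e * n%:R.
  rewrite mulrC -ler_pdivrMr //; apply: le_trans hN2 _; rewrite ler_nat; lia.
have Kn : K%:R <= e / 2 * n%:R.
  rewrite mulrC -ler_pdivrMr ?divr_gt0 //; apply: le_trans hN1 _; rewrite ler_nat; lia.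
have hi : (u n)%:R <= (u m + C)%:R / m%:R * n%:R + K%:R :> R.
  have := uq (n %/ m)%N (n %% m)%N; rewrite -divn_eq => un.
  have := ur _ (ltn_pmod n m0) => urm.
  have : (u n)%:R <= (n %/ m)%:R * (u m + C)%:R + K%:R :> R.
    by rewrite -natrM -natrD ler_nat; lia.
  move=> un2; apply: le_trans un2 _; rewrite lerD2r mulrC -mulrA ler_wpM2l // mulrC.
  by rewrite ler_pdivlMr // -natrM ler_nat leq_divM.
have hi2 : (u m + C)%:R / m%:R * n%:R <= (inf E + e / 2) * n%:R.
  by rewrite ler_pM2r // ltW.
rewrite natrD in lo; rewrite ler_norml; apply/andP; split; last first.
  rewrite mulrDl in hi2; lra.
lra.
Qed.

End Rate.

(** * Simultaneous Diophantine approximation *)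

Section Approximation.
Local Open Scope ring_scope.

(* Dirichlet's pigeonhole argument, applied to the fractional parts of the
   multiples [d * a j] sorted into boxes of side [1 / Q]. *)
Lemma simultaneous_approximation (R : realType) (k : nat) (a : 'I_k -> R) (Q : nat) :
  (0 < Q)%N -> exists d (p : 'I_k -> int), (0 < d)%N /\
    forall j, `|d%:R * a j - (p j)%:~R| < Q%:R^-1.
Proof.
case: Q => // Q _; set q := Q.+1%:R : R.
have q0 : 0 < q by rewrite ltr0n.
pose fr (d : nat) j : R := d%:R * a j - (Num.floor (d%:R * a j))%:~R.
have fr0 d j : 0 <= fr d j by rewrite subr_ge0 floor_le.
have fr1 d j : fr d j < 1.
  by rewrite ltrBlDl; have /andP[_] := floor_itv (d%:R * a j); rewrite intrD.
pose box (d : 'I_(Q.+1 ^ k).+1) : {ffun 'I_k -> 'I_Q.+1} :=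
  [ffun j => inord (Num.trunc (q * fr d j))].
have [d1 [d2 [d12 boxE]]] : exists d1 d2 : 'I_(Q.+1 ^ k).+1, (d1 < d2)%N /\ box d1 = box d2.
  have /injectivePn[d [d' dd' bE]] : ~~ injectiveb box.
    by apply/negP => /injectiveP/leq_card; rewrite card_ffun !card_ord ltnn.
  have [lt|lt|eq] := ltngtP d d'; [by exists d, d'|by exists d', d|].
  by move: dd'; rewrite (ord_inj eq) eqxx.
exists (d2 - d1)%N, (fun j => Num.floor (d2%:R * a j) - Num.floor (d1%:R * a j)).
split=> [|j]; first by rewrite subn_gt0.
have tr d : (Num.trunc (q * fr d j))%:R <= q * fr d j < (Num.trunc (q * fr d j)).+1%:R.
  by apply: truncn_itv; rewrite mulr_ge0 // ltW.
have trQ d : (Num.trunc (q * fr d j) < Q.+1)%N.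
  rewrite truncn_lt_nat; last by rewrite mulr_ge0 // ltW.
  by rewrite -[X in _ < X]mulr1 ltr_pM2l.
have trE : Num.trunc (q * fr d1 j) = Num.trunc (q * fr d2 j).
  have := congr1 (fun b : {ffun 'I_k -> 'I_Q.+1} => val (b j)) boxE.
  by rewrite !ffunE /= !inordK.
have := tr d1; rewrite trE; have := tr d2; rewrite -[(Num.trunc _).+1%:R]natr1.
move: (Num.trunc _)%:R => t /andP[t2 t2'] /andP[t1 t1'].
have -> : (d2 - d1)%:R * a j - (Num.floor (d2%:R * a j) - Num.floor (d1%:R * a j))%:~R
    = fr d2 j - fr d1 j.
  rewrite natrB; last exact: ltnW.
  by rewrite intrB /fr; ring.
rewrite -(ltr_pM2l q0) mulfV ?gt_eqF // -[X in X * `|_|](gtr0_norm q0) -normrM.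
by rewrite mulrBr ltr_norml; apply/andP; split; lra.
Qed.

End Approximation.

(** * Inequalities for scl of integral chains *)

Section Seminorm.
Local Open Scope classical_set_scope.
Local Open Scope ring_scope.
Variables (R : realType) (G : groupType).
Implicit Types (g h x y : G) (gs hs : seq G) (a b t : R).
Local Notation D := (@derived_subgroup G).
Local Notation adm gs := (D (\prod_(g <- gs) g)%g).
Local Notation S := (@scl_sum R G).
Local Notation chain := {freeg G / R}.

Lemma scl_sum_rate gs : adm gs -> is_rate (fun n => cl_sum (powers n gs)) (S gs).
Proof.
move=> dg; have [a ha] := @fekete_rate R _ _ (fun m n => cl_powersD m n dg).
by have -> : S gs = a by exact: is_rate_lim ha.
Qed.

Lemma scl_sum_ge0 gs : adm gs -> 0 <= S gs.
Proof. by move=> /scl_sum_rate/is_rate_ge0. Qed.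

Lemma scl_sum_cat gs hs : adm gs -> adm hs -> S (gs ++ hs) <= S gs + S hs.
Proof.
move=> dg dh.
apply: (is_rate_le (C := 0) (scl_sum_rate (derived_prod_cat dg dh))
  (is_rateD (scl_sum_rate dg) (scl_sum_rate dh))) => n.
by rewrite addn0 cl_powers_cat.
Qed.

Lemma scl_sum_perm gs hs : perm_eq gs hs -> adm gs -> S gs = S hs.
Proof.
move=> gh dg; have dh := derived_prod_perm gh dg.
apply/eqP; rewrite eq_le; apply/andP; split.
  apply: (is_rate_le (C := 0) (scl_sum_rate dg) (scl_sum_rate dh)) => n.
  by rewrite addn0 cl_powers_perm // perm_sym.
apply: (is_rate_le (C := 0) (scl_sum_rate dh) (scl_sum_rate dg)) => n.
by rewrite addn0 cl_powers_perm.
Qed.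

Lemma scl_sum_cancel gs hs : adm gs -> adm hs -> S gs <= S (gs ++ hs) + S hs.
Proof.
move=> dg dh; apply: (is_rate_le (scl_sum_rate dg)
  (is_rateD (scl_sum_rate (derived_prod_cat dg dh)) (scl_sum_rate dh))) => n.
exact: cl_powers_cancel.
Qed.

Lemma scl_sum_nil : S [::] = 0.
Proof.
apply: is_rate_lim; apply: (_ : is_rate (fun n => cl_sum (powers n [::])) 0).
rewrite (_ : (fun n => _) = (fun=> 0%N)); first exact: is_rate0.
by apply/funext => n; apply: cl_powers_eq0; rewrite big_nil.
Qed.

Lemma scl_sum_copies_le k gs : adm gs -> S (flatten (nseq k gs)) <= k%:R * S gs.
Proof.
move=> dg; elim: k => [|k IHk] /=; first by rewrite scl_sum_nil mul0r.
apply: le_trans (scl_sum_cat dg (derived_prod_copies k dg)) _.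
by rewrite -natr1 mulrDl mul1r addrC lerD2r.
Qed.

Lemma scl_sum_copies_ge k gs : (0 < k)%N -> adm gs ->
  k%:R * S gs <= S (flatten (nseq k gs)).
Proof.
move=> k0 dg; apply: (is_rate_le (is_rateM k0 (scl_sum_rate dg))
  (scl_sum_rate (derived_prod_copies k dg))) => n.
exact: cl_powers_copies.
Qed.

Lemma coeff_chain_of x gs : coeff x (chain_of R gs) = (count_mem x gs)%:R.
Proof.
elim: gs => [|g gs IHgs]; first by rewrite /chain_of big_nil coeff0.
by rewrite /chain_of big_cons coeffD IHgs coeffU mul1r natrD.
Qed.

Definition scl_fam k (L : 'I_k -> seq G) (p : 'I_k -> nat) :=
  flatten [seq flatten (nseq (p j) (L j)) | j <- index_enum 'I_k].

Lemma count_scl_fam k (L : 'I_k -> seq G) p (P : pred G) :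
  count P (scl_fam L p) = (\sum_j p j * count P (L j))%N.
Proof.
rewrite /scl_fam count_flatten sumnE !big_map; apply: eq_bigr => j _.
by elim: (p j) => //= n IHn; rewrite count_cat IHn mulSn.
Qed.

Lemma adm_scl_fam k (L : 'I_k -> seq G) p : (forall j, adm (L j)) -> adm (scl_fam L p).
Proof.
move=> dL; rewrite /scl_fam; elim: (index_enum _) => [|j s IHs] /=.
  by rewrite big_nil; exact: derived1.
by apply: derived_prod_cat => //; exact: derived_prod_copies.
Qed.

Lemma scl_sum_fam k (L : 'I_k -> seq G) p : (forall j, adm (L j)) ->
  S (scl_fam L p) <= \sum_j (p j)%:R * S (L j).
Proof.
move=> dL; rewrite /scl_fam.
have: forall s : seq 'I_k, adm (flatten [seq flatten (nseq (p j) (L j)) | j <- s]) /\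
    S (flatten [seq flatten (nseq (p j) (L j)) | j <- s]) <= \sum_(j <- s) (p j)%:R * S (L j).
  elim=> [|j s [ds IHs]] /=.
    by rewrite !big_nil scl_sum_nil; split=> //; exact: derived1.
  have dj := derived_prod_copies (p j) (dL j).
  split; first exact: derived_prod_cat.
  apply: le_trans (scl_sum_cat dj ds) _; rewrite big_cons lerD //.
  exact: scl_sum_copies_le.
by move=> /(_ (index_enum 'I_k))[].
Qed.

(** Moving the terms with negative [p j] to the other side leaves an equality of lists up to
    permutation, to which cancellation and subadditivity apply. *)
Lemma scl_sum_int_le k (L : 'I_k -> seq G) gs d (p : 'I_k -> int) :
  (0 < d)%N -> adm gs -> (forall j, adm (L j)) ->
  (forall x, d%:Z * (count_mem x gs)%:Z = \sum_j p j * (count_mem x (L j))%:Z) ->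
  d%:R * S gs <= \sum_j `|p j|%:~R * S (L j).
Proof.
move=> d0 dg dL cE.
pose pos j := if 0 <= p j then `|p j|%N else 0%N.
pose neg j := if 0 <= p j then 0%N else `|p j|%N.
have pE j : p j = (pos j)%:Z - (neg j)%:Z by rewrite /pos /neg; case: ifP; lia.
have nE j : `|p j| = (pos j)%:Z + (neg j)%:Z by rewrite /pos /neg; case: ifP; lia.
have ddg := derived_prod_copies d dg.
have dpos := adm_scl_fam pos dL; have dneg := adm_scl_fam neg dL.
have perm : perm_eq (flatten (nseq d gs) ++ scl_fam L neg) (scl_fam L pos).
  apply/allP => x _ /=; rewrite count_cat !count_scl_fam.
  have -> : count_mem x (flatten (nseq d gs)) = (d * count_mem x gs)%N.
    by elim: (d) => //= n IHn; rewrite count_cat IHn mulSn.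
  apply/eqP; apply: (can_inj absz_nat); rewrite PoszD PoszM cE.
  rewrite !(big_morph Posz PoszD (erefl _)) -big_split /=; apply: eq_bigr => j _.
  by rewrite !PoszM -mulrDl {1}pE subrK.
apply: le_trans (scl_sum_copies_ge d0 dg) _.
apply: le_trans (scl_sum_cancel ddg dneg) _.
rewrite (scl_sum_perm perm); last exact: derived_prod_cat.
apply: le_trans (lerD (scl_sum_fam pos dL) (scl_sum_fam neg dL)) _.
rewrite -big_split /=; apply: ler_sum => j _.
by rewrite nE intrD mulrDl.
Qed.

(* The rounding error of a good enough approximation is an integral chain with
   coefficients smaller than 1, hence it vanishes. *)
Lemma scl_sum_span_le k (L : 'I_k -> seq G) (a : 'I_k -> R) gs :
  adm gs -> (forall j, adm (L j)) -> chain_of R gs = \sum_j a j *: chain_of R (L j) ->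
  S gs <= \sum_j `|a j| * S (L j).
Proof.
move=> dg dL gsE; apply/ler_addgt0Pr => e e0.
set M := \sum_j S (L j); have M0 : 0 <= M by apply: sumr_ge0 => j _; exact: scl_sum_ge0.
pose C := (\sum_j size (L j))%N.
(* [Q] exceeds the total length of the lists, so that rounding errors in the coefficients stay below
   1, and it exceeds [M / e], so that rounding changes the bound by at most [e]. *)
have [Q0 hQ0] := nat_ge (M / e); pose Q := (C + Q0).+1.
have QR : 0 < Q%:R :> R by rewrite ltr0n.
have [d [p [d0 hp]]] := simultaneous_approximation a (isT : 0 < Q)%N.
have d0R : 0 < d%:R :> R by rewrite ltr0n.
have cE x : d%:Z * (count_mem x gs)%:Z = \sum_j p j * (count_mem x (L j))%:Z.
  have gsx : (count_mem x gs)%:R = \sum_j a j * (count_mem x (L j))%:R.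
    rewrite -coeff_chain_of gsE raddf_sum; apply: eq_bigr => j _.
    by rewrite /= coeffZ coeff_chain_of.
  apply/eqP; rewrite -subr_eq0; set z := _ - _.
  suff : `|z| < 1 by lia.
  rewrite -(ltr_int R) intr_norm /z intrB intrM -!pmulrn gsx mulr_sumr.
  rewrite (rmorph_sum intr) -sumrB.
  apply: (@le_lt_trans _ _ (\sum_j Q%:R^-1 * (size (L j))%:R)); last first.
    rewrite -mulr_sumr -natr_sum mulrC ltr_pdivrMr // mul1r ltr_nat /Q /C; lia.
  apply: le_trans (ler_norm_sum _ _ _) _; apply: ler_sum => j _.
  rewrite /= intrM -pmulrn mulrA -mulrBl normrM ler_pM //; first exact: ltW.
  by rewrite normr_nat ler_nat count_size.
have h := scl_sum_int_le d0 dg dL cE.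
rewrite -(ler_pM2l d0R); apply: le_trans h _.
have MQ : Q%:R^-1 * M <= e.
  rewrite mulrC ler_pdivrMr // mulrC -ler_pdivrMr //; apply: le_trans hQ0 _.
  by rewrite ler_nat /Q; lia.
apply: (@le_trans _ _ (\sum_j (d%:R * `|a j| + Q%:R^-1) * S (L j))).
  apply: ler_sum => j _; rewrite ler_wpM2r ?scl_sum_ge0 // intr_norm.
  rewrite -{1}[(p j)%:~R](subKr (d%:R * a j)) (le_trans (ler_normB _ _)) //.
  by rewrite normrM normr_nat lerD2l ltW.
under eq_bigr do rewrite mulrDl -mulrA.
rewrite big_split /= -!mulr_sumr -/M mulrDr lerD2l; apply: le_trans MQ _.
by rewrite ler_peMl ?(ltW e0) // ler1n.
Qed.

End Seminorm.

(** * Extension of scl to real boundaries *)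

Ltac chain_eq := apply/eqP/freeg_eqP => ?; rewrite !(coeffD, coeffN, coeffZ, coeffU, coeff0); ring.

Section Extension.
Local Open Scope classical_set_scope.
Local Open Scope ring_scope.
Variables (R : realType) (G : groupType).
Implicit Types (g h x y : G) (gs hs : seq G) (a b t : R) (u v : {freeg G / R}).
Local Notation D := (@derived_subgroup G).
Local Notation adm gs := (D (\prod_(g <- gs) g)%g).
Local Notation S := (@scl_sum R G).
Local Notation chain := {freeg G / R}.
Implicit Types V : set chain.

Lemma subspaceD V u v : is_subspace V -> V u -> V v -> V (u + v).
Proof. by case=> _ VZ Vu Vv; rewrite -[u]scale1r; exact: VZ. Qed.

Lemma subspaceZ V a u : is_subspace V -> V u -> V (a *: u).
Proof. by case=> V0 VZ Vu; rewrite -[_ *: _]addr0; exact: VZ. Qed.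

Lemma subspaceB V u v : is_subspace V -> V u -> V v -> V (u - v).
Proof. by move=> sV Vu Vv; apply: subspaceD => //; rewrite -scaleN1r; exact: subspaceZ. Qed.

Lemma subspace_spanned_subspace (E : set chain) : is_subspace (subspace_spanned E).
Proof.
split=> [V [[]]//|a u v Eu Ev V VE]; have [[_ VZ] _] := VE.
by apply: VZ; [exact: Eu|exact: Ev].
Qed.

Lemma subspace_spanned_sub (E : set chain) : E `<=` subspace_spanned E.
Proof. by move=> u Eu V [_]; apply. Qed.

Lemma subspace_spanned_min (E V : set chain) : is_subspace V -> E `<=` V ->
  subspace_spanned E `<=` V.
Proof. by move=> sV EV u; apply. Qed.

Lemma chain_of_nil : chain_of R ([::] : seq G) = 0.
Proof. by rewrite /chain_of big_nil. Qed.

Lemma chain_of_cons g gs : chain_of R (g :: gs) = << g >> + chain_of R gs.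
Proof. by rewrite /chain_of big_cons. Qed.

Lemma chain_of_nseq n g : chain_of R (nseq n g) = n%:R *: << g >>.
Proof.
elim: n => [|n IHn]; first by rewrite chain_of_nil scale0r.
by rewrite chain_of_cons IHn -natr1 scalerDl scale1r addrC.
Qed.

(** Modulo the generators of [B1] the chain is the single element given by its product, and the [g]
    with [<< g >>] in [B1] form a subgroup containing all commutators. *)
Lemma B1_chain_of gs : adm gs -> B1 (chain_of R gs).
Proof.
set V := @B1 R G; have sV : is_subspace V by exact: subspace_spanned_subspace.
have VM x y : V (<< x >> + << y >> - << (x * y)%g >>).
  by apply: subspace_spanned_sub; exists x => //; exists y.
have V1 : V << 1%g >> by have := VM 1%g 1%g; rewrite mulg1 addrK.
have VD g : D g -> V << g >>.
  move=> /(_ [set g | V << g >>]); apply; split=> [|_ [x _ [y _ <-]]].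
    split=> // [x y Vx Vy|x Vx] /=.
      have := subspaceB sV (subspaceD sV Vx Vy) (VM x y).
      by rewrite opprB addrC subrK.
    have := subspaceB sV (subspaceD sV (VM x x^-1%g) V1) Vx.
    by rewrite mulgV subrK addrC addKr.
  have := VM (y * x)%g [~ x, y]%g; rewrite -commgC => Vc.
  have := subspaceD sV (subspaceB sV Vc (VM x y)) (VM y x) => /=.
  by congr V; chain_eq.
suff h : V (chain_of R gs - << (\prod_(g <- gs) g)%g >>).
  by move=> /VD /(subspaceD sV h); rewrite subrK.
elim: gs => [|g gs IHgs].
  rewrite chain_of_nil big_nil; exact: subspaceB sV (proj1 sV) V1.
rewrite chain_of_cons big_cons; have := subspaceD sV IHgs (VM g (\prod_(g <- gs) g)%g).
by congr V; chain_eq.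
Qed.

(** The costs of all decompositions of [u] into integral chains; their infimum will be the
    seminorm. *)
Definition scl_reprs u : set R := [set t | exists s : seq (R * seq G),
  [/\ forall p, p \in s -> adm p.2, u = \sum_(p <- s) p.1 *: chain_of R p.2 &
      t = \sum_(p <- s) `|p.1| * S p.2]].

Lemma scl_reprs_ge0 u t : scl_reprs u t -> 0 <= t.
Proof.
case=> s [ds _ ->]; rewrite big_seq; apply: sumr_ge0 => p ps.
by rewrite mulr_ge0 // scl_sum_ge0 //; exact: ds _ ps.
Qed.

Lemma scl_reprs0 : scl_reprs 0 0.
Proof. by exists [::]; split=> [p||]; rewrite ?in_nil ?big_nil. Qed.

Lemma scl_reprsZ a u t : scl_reprs u t -> scl_reprs (a *: u) (`|a| * t).
Proof.
case=> s [ds -> ->]; exists [seq (a * p.1, p.2) | p <- s].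
rewrite !big_map scaler_sumr mulr_sumr; split.
- by move=> _ /mapP[p ps ->] /=; exact: ds _ ps.
- by apply: eq_bigr => p _; rewrite scalerA.
- by apply: eq_bigr => p _; rewrite normrM mulrA.
Qed.

Lemma scl_reprsD u v t t' : scl_reprs u t -> scl_reprs v t' ->
  scl_reprs (u + v) (t + t').
Proof.
case=> s [ds -> ->] [r [dr -> ->]]; exists (s ++ r); rewrite !big_cat; split=> // p.
by rewrite mem_cat => /orP[/ds|/dr].
Qed.

Lemma scl_reprs_chain_of gs : adm gs -> scl_reprs (chain_of R gs) (S gs).
Proof.
move=> dg; exists [:: (1, gs)]; rewrite !big_seq1 scale1r normr1 mul1r.
by split=> // p; rewrite inE => /eqP ->.
Qed.

Lemma scl_reprs_chain_of_ge gs t : adm gs -> scl_reprs (chain_of R gs) t -> S gs <= t.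
Proof.
move=> dg [s [ds gsE ->]]; rewrite big_tnth; rewrite big_tnth in gsE.
apply: (scl_sum_span_le dg _ gsE) => j; apply: ds; exact: mem_tnth.
Qed.

Lemma scl_sum_trivial gs : (forall n, reach (powers n gs) 0) -> adm gs /\ S gs = 0.
Proof.
move=> gs0; split.
  by have := reach_derived (gs0 1%N); rewrite /powers (eq_map (@expg1 G)) map_id.
apply: is_rate_lim; apply: (_ : is_rate (fun n => cl_sum (powers n gs)) 0).
rewrite (_ : (fun n => _) = (fun=> 0%N)); first exact: is_rate0.
by apply/funext => n; apply/eqP; rewrite -leqn0; exact: reach_le.
Qed.

Lemma scl_reprs_trivial gs : (forall n, reach (powers n gs) 0) ->
  scl_reprs (chain_of R gs) 0.
Proof. by move=> /scl_sum_trivial[dg <-]; exact: scl_reprs_chain_of. Qed.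

Lemma reach_conj_inv x h n : reach (powers n [:: x; h * x^-1 * h^-1]%g) 0.
Proof.
exists 1%g; last exact: cp1.
have := cjp_cons h (x ^+ n)%g (cjp_cons 1%g ((h * x^-1 * h^-1) ^+ n)%g (cjp_nil G)).
congr conjugate_product.
by rewrite conjX !mulg1 invg1 mulg1 mul1g -conjM expVgn mulgV mulg1 mulgV.
Qed.

Lemma reach_power_inv g m n : reach (powers n ((g ^+ m)%g :: nseq m g^-1%g)) 0.
Proof.
apply: reach_prod1; rewrite /powers /= big_cons map_nseq.
have -> (z : G) : (\prod_(x <- nseq m z) x = z ^+ m)%g.
  by elim: m => [|m IHm]; rewrite ?big_nil ?expg0 //= big_cons IHm expgS.
by rewrite -!expgnA mulnC expVgn mulgV.
Qed.

(** A subtracted element is traded for its inverse: [x + h x^-1 h^-1] and [g^n + n g^-1] are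
    integral chains of scl zero, and the generators of [H_subspace] are combinations of such
    chains. *)
Lemma scl_reprs_H u : H_subspace u -> scl_reprs u 0.
Proof.
move: u; apply: subspace_spanned_min.
  split=> [|a u v u0 v0]; first exact: scl_reprs0.
  by have := scl_reprsD (scl_reprsZ a u0) v0; rewrite mulr0 addr0.
have inv0 x h : scl_reprs (<< x >> + << (h * x^-1 * h^-1)%g >>) 0.
  have := scl_reprs_trivial (reach_conj_inv x h).
  by rewrite !chain_of_cons chain_of_nil addr0.
have sub0 u v : scl_reprs u 0 -> scl_reprs v 0 -> scl_reprs (u - v) 0.
  by move=> u0 v0; have := scl_reprsD u0 (scl_reprsZ (-1) v0); rewrite mulr0 addr0 scaleN1r.
move=> _ [[[g [n ->]]|[g [n ->]]]|[g [h ->]]].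
- have := scl_reprs_trivial (reach_power_inv g n); rewrite chain_of_cons chain_of_nseq => p0.
  have := scl_reprsZ n%:R (inv0 g 1%g); rewrite mulr0 mul1g invg1 mulg1 => i0.
  by have := sub0 _ _ p0 i0;
    rewrite scalerDr opprD addrACA subrr addr0 addrC; congr scl_reprs; chain_eq.
- have := scl_reprs_trivial (reach_power_inv g^-1%g n).
  by rewrite chain_of_cons chain_of_nseq invgK expVgn.
- have := sub0 _ _ (inv0 g h) (inv0 (h * g * h^-1)%g 1%g).
  rewrite mul1g invg1 mulg1 !invgM invgK mulgA; congr scl_reprs; chain_eq.
Qed.

Lemma scl_reprs_B1 u : B1 u -> scl_reprs u !=set0.
Proof.
move: u; apply: subspace_spanned_min.
  split=> [|a u v [t ut] [t' vt]]; first by exists 0; exact: scl_reprs0.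
  by exists (`|a| * t + t'); apply: scl_reprsD => //; exact: scl_reprsZ.
move=> _ [x _ [y _ <-]].
(* [x + y - xy] is the difference of the integral boundaries [x + y + (xy)^-1] and
   [xy + (xy)^-1]. *)
have [t1 ht1] : scl_reprs (chain_of R [:: x; y; (x * y)^-1]%g) !=set0.
  eexists; apply: scl_reprs_chain_of; rewrite !big_cons big_nil.
  by rewrite mulg1 mulgA mulgV; exact: derived1.
have [t2 ht2] : scl_reprs (chain_of R [:: x * y; (x * y)^-1]%g) !=set0.
  eexists; apply: scl_reprs_chain_of; rewrite !big_cons big_nil.
  by rewrite mulg1 mulgV; exact: derived1.
exists (t1 + `|-1| * t2); have := scl_reprsD ht1 (scl_reprsZ (-1) ht2).
by rewrite scaleN1r !chain_of_cons chain_of_nil; congr scl_reprs; chain_eq.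
Qed.

Lemma extends_scl_exists : exists N : chain -> R, extends_scl N.
Proof.
pose N u := inf (scl_reprs u).
have lb u : has_lbound (scl_reprs u) by exists 0 => t /scl_reprs_ge0.
(* One inequality suffices for homogeneity: applied to the inverse of [a] it gives the reverse
   one. *)
have NZ_le a u : a != 0 -> B1 u -> N (a *: u) <= `|a| * N u.
  move=> a0 Bu; rewrite mulrC -ler_pdivrMr ?normr_gt0 //.
  apply: lb_le_inf; first exact: scl_reprs_B1.
  move=> t ut; rewrite ler_pdivrMr ?normr_gt0 // mulrC; apply: ge_inf => //.
  exact: scl_reprsZ.
have N0 u : scl_reprs u 0 -> N u = 0.
  move=> u0; apply/eqP; rewrite eq_le ge_inf //=; apply: lb_le_inf; first by exists 0.
  by move=> t /scl_reprs_ge0.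
exists N; split; [split| |].
- move=> u Bu; apply: lb_le_inf; first exact: scl_reprs_B1.
  by move=> t /scl_reprs_ge0.
- move=> a u Bu; have [->|a0] := eqVneq a 0.
    by rewrite scale0r normr0 mul0r N0 //; exact: scl_reprs0.
  apply/eqP; rewrite eq_le NZ_le //= mulrC -ler_pdivlMr ?normr_gt0 // mulrC.
  rewrite -normfV -{1}[u]scale1r -(mulVf a0) -scalerA NZ_le ?invr_eq0 //.
  exact: (subspaceZ a (subspace_spanned_subspace _) Bu).
- move=> u v Bu Bv; rewrite -lerBlDr; apply: lb_le_inf; first exact: scl_reprs_B1.
  move=> t ut; rewrite lerBlDr -lerBlDl; apply: lb_le_inf; first exact: scl_reprs_B1.
  move=> t' vt'; rewrite lerBlDl; apply: ge_inf => //; exact: scl_reprsD.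
- by move=> u /scl_reprs_H/N0.
- move=> gs dg; apply/eqP; rewrite eq_le ge_inf //=; last exact: scl_reprs_chain_of.
  apply: lb_le_inf; first by exists (S gs); exact: scl_reprs_chain_of.
  by move=> t; exact: scl_reprs_chain_of_ge.
Qed.

(** Existence ensures that [xget] selects a genuine extension instead of falling back on its
    default. *)
Lemma extends_scl_scl : extends_scl (@scl R G).
Proof. exact: (@xgetPex _ _ (@extends_scl R G) extends_scl_exists). Qed.

Lemma scl_chain_of gs : adm gs -> scl (chain_of R gs) = S gs.
Proof. by case: extends_scl_scl => _ _; apply. Qed.

Lemma scl_H u : H_subspace u -> scl u = 0.
Proof. by case: extends_scl_scl => _ H0 _; exact: H0. Qed.

Lemma H_subspace_conj_inv x h :
  H_subspace (chain_of R [:: x; h * x^-1 * h^-1]%g).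
Proof.
have sH : is_subspace (@H_subspace R G) by exact: subspace_spanned_subspace.
have H1 : H_subspace (<< x >> - << (h * x * h^-1)%g >> : chain).
  by apply: subspace_spanned_sub; right; exists x, h.
have H2 : H_subspace (<< (h * x^-1 * h^-1)%g >> + << (h * x * h^-1)%g >> : chain).
  apply: subspace_spanned_sub; left; right; exists (h * x * h^-1)%g, 1%N.
  by rewrite scale1r expg1 !invgM invgK mulgA.
have := subspaceD sH H1 H2; rewrite !chain_of_cons chain_of_nil.
by congr H_subspace; chain_eq.
Qed.

End Extension.

Local Open Scope classical_set_scope.
Local Open Scope group_scope.

(** * Isometric homomorphisms *)

Section LowerBound.
Variables (R : realType) (G : groupType) (f : G -> int) (D : nat).
Hypothesis qf : odd_quasimorphism f D.
Implicit Types (g x y : G) (gs : seq G).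

Lemma qm_prod2 x y : (`|f (x * y) - f x - f y| <= D%:Z)%R.
Proof. by case: qf => _; apply. Qed.

(** As [[~ x, y]] is [x^-1] times a conjugate of [x], its value is at most [D + 2 D], and
    multiplying it onto the product costs another [D]. *)
Lemma qm_commutator_product g k : is_commutator_product g k ->
  (`|f g| <= (4 * D * k)%:Z)%R.
Proof.
case=> s <- ->; elim: s => [|[x y] s IHs].
  by have := (proj1 qf) 1; rewrite big_nil invg1 /= muln0; move: (f _) => z; lia.
rewrite big_cons /=; set r := \prod_(p <- s) _ in IHs *.
have c1 := qm_prod2 [~ x, y] r; have c2 := qm_prod2 x^-1 (x ^ y).
rewrite -commgEl (proj1 qf) in c2.
have c3 : (`|f (x ^ y) - f x| <= (D + D)%:Z)%R.
  by have := qm_conj qf y^-1 x; rewrite invgK conjgE mulgA.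
rewrite mulnS; move: c1 c2 c3 IHs.
by move: (f [~ x, y]) (f r) (f x) (f (x ^ y)) (f _) => *; lia.
Qed.

Lemma qm_conjugate_product gs g : conjugate_product gs g ->
  (`|f g - \sum_(x <- gs) f x| <= (3 * D * size gs)%:Z)%R.
Proof.
elim: gs g => [|x gs IHgs] g.
  case=> [[]] // _ ->; have := (proj1 qf) 1.
  by rewrite !big_nil invg1 /= muln0; move: (f _) => z; lia.
case/cjp_consP=> h [y [/IHgs yP ->]]; rewrite big_cons /=.
have := qm_prod2 (h * x * h^-1) y; have := qm_conj qf h x.
by move: yP; move: (f _) (f _) (f _) (f _) (\sum_(_ <- _) _)%R => *; nia.
Qed.

(** Up to a constant, [n] times the sum of slopes is the value of [f] on a product of conjugates of
    [n]-th powers. That value is at most [4 D] times the commutator length, which grows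
    sublinearly. *)
Lemma scl_sum_slope gs (sl : G -> int) :
  derived_subgroup (\prod_(g <- gs) g) -> scl_sum R gs = 0%R ->
  (forall g, is_slope f g (sl g)) -> (\sum_(g <- gs) sl g = 0)%R.
Proof.
move=> dg sgs slP; set s := (\sum_(g <- gs) sl g)%R.
have [B hB] : exists B : nat, forall n,
    (`|\sum_(g <- powers n gs) f g - s * n%:Z| <= B%:Z)%R.
  rewrite /s; elim: gs {dg sgs s} => [|g gs [B hB]].
    by exists 0%N => n; rewrite !big_nil mul0r.
  have [B' hB'] := slP g; exists (B + B')%N => n.
  have := hB n; have := hB' n; rewrite /= !big_cons.
  move: (\sum_(_ <- _) _)%R (\sum_(_ <- _) _)%R (f _) (sl _) => *; lia.
have bound n : (`|s| * n%:Z <= (4 * D * cl_sum (powers n gs))%:Z + (3 * D * size gs + B)%:Z)%R.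
  have [g gP /qm_commutator_product gk] := reach_cl_powers n dg.
  have := qm_conjugate_product gP; have := hB n; rewrite size_powers.
  move: gk; move: (f g) (\sum_(_ <- _) _)%R => *; nia.
apply/eqP/negPn/negP => s0; set M := (3 * D * size gs + B)%N in bound.
(* With this rate [4 D] times the commutator length is at most [n / 2]; a nonzero integer [s] then
   forces [n <= 2 M], against the choice of [n] below. *)
pose e : R := ((8 * D).+1%:R^-1)%R.
have e0 : (0 < e)%R by rewrite invr_gt0 ltr0n.
have [N hN] := scl_sum_rate dg e0.
have := hN (N + 2 * M + 1)%N; rewrite sgs mul0r subr0 normr_nat => /(_ ltac:(lia)).
have := bound (N + 2 * M + 1)%N; set n := (N + 2 * M + 1)%N.
set c := cl_sum _ => cn.
rewrite mulrC ler_pdivlMr ?ltr0n // -natrM ler_nat; nia.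
Qed.

End LowerBound.

(** * Consequences of isometry *)

Section Isometric.
Variables (R : realType) (G F : groupType) (phi : group_hom G F).
Hypothesis hphi : isometric R phi.
Variables (T : choiceType) (rw : G -> seq (T * bool)) (x0 : T * bool).
Hypothesis rwP : coordinates rw.
Implicit Types (g h x y : G) (gs : seq G) (ps : seq (G * G)).

Lemma chain_map_chain_of gs :
  chain_map phi (chain_of R gs) = chain_of R [seq phi g | g <- gs].
Proof.
have add := lift_is_additive (fun g => << phi g >> : {freeg F / R})%R.
have add0 : (chain_map phi 0 = 0 :> {freeg F / R})%R.
  by have := add 0%R 0%R; rewrite /chain_map !subrr.
have addN u : (chain_map phi (- u) = - chain_map phi u :> {freeg F / R})%R.
  by rewrite -sub0r [LHS]add -/(chain_map phi 0%R) add0 sub0r.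
elim: gs => [|g gs IHgs]; first by rewrite !chain_of_nil.
rewrite /= !chain_of_cons -IHgs -[in LHS](opprK (chain_of R gs)) [LHS]add.
by rewrite -/(chain_map phi (- _)%R) addN opprK liftU scale1r.
Qed.

(** Stands for the chain of differences [p.1 - p.2], with inverses in place of negative coefficients
    so that [scl_sum] applies. *)
Definition difference_list ps := flatten [seq [:: p.1; p.2^-1] | p <- ps].

Lemma difference_list_ab ps : ab_eq (\prod_(g <- difference_list ps) g)
  ((\prod_(p <- ps) p.1) * (\prod_(p <- ps) p.2)^-1).
Proof.
elim: ps => [|p ps IHps].
  by rewrite /difference_list /= !big_nil invg1 mulg1; exact: ab_eq_refl.
rewrite /difference_list /= !big_cons invgM !mulgA.
set A := \prod_(q <- ps) q.1; set B := \prod_(q <- ps) q.2.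
apply: ab_eq_trans (ab_eqM (ab_eq_refl _) IHps) _.
rewrite -!mulgA; apply: ab_eqM; first exact: ab_eq_refl.
by have := ab_eqC p.2^-1 (A * B^-1); rewrite -!mulgA.
Qed.

(** The chain of differences is a boundary whose image lies in [H_subspace]. Isometry makes its scl
    vanish, and then its total slope vanishes too. *)
Lemma isometric_slope ps : (forall p, p \in ps -> conjugate (phi p.1) (phi p.2)) ->
  ab_eq (\prod_(p <- ps) p.1) (\prod_(p <- ps) p.2) -> forall w,
  (\sum_(p <- ps) slope (brooks rw w) p.1 = \sum_(p <- ps) slope (brooks rw w) p.2)%R.
Proof.
move=> cps aps w.
have dps : derived_subgroup (\prod_(g <- difference_list ps) g).
  apply: (iffLR (ab_eq1 _)); apply: ab_eq_trans (difference_list_ab ps) _.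
  exact: (iffRL (ab_eq1 _)).
have Hps : H_subspace (chain_map phi (chain_of R (difference_list ps))).
  rewrite chain_map_chain_of; have sH : is_subspace (@H_subspace R F).
    exact: subspace_spanned_subspace.
  elim: ps cps {aps dps} => [_|p ps IHps cps].
    by rewrite chain_of_nil; exact: (proj1 sH).
  have [h ph] := cps p (mem_head _ _).
  rewrite /difference_list /= !chain_of_cons addrA; apply: (subspaceD sH); last first.
    by apply: IHps => q qps; apply: cps; rewrite inE qps orbT.
  have := @H_subspace_conj_inv R F (phi p.1) h; rewrite !chain_of_cons chain_of_nil addr0.
  by rewrite gmulfV ph !invgM invgK mulgA.
have S0 : scl_sum R (difference_list ps) = 0%R.
  by rewrite -(scl_chain_of R dps) (hphi (@B1_chain_of R _ _ dps)) scl_H.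
have := scl_sum_slope (brooks_qm rwP w) dps S0 (slope_brooksP rwP x0 w).
rewrite /difference_list big_flatten big_map => h.
apply/eqP; rewrite -subr_eq0 -sumrB; apply/eqP; rewrite -[RHS]h; apply: eq_bigr => p _.
by rewrite !big_cons big_nil /= addr0 (slopeV rwP x0).
Qed.

Lemma isometric_slope1 x y w : conjugate (phi x) (phi y) -> ab_eq x y ->
  slope (brooks rw w) x = slope (brooks rw w) y.
Proof.
move=> cxy axy; have := @isometric_slope [:: (x, y)].
rewrite !big_seq1 => /(_ _ axy w); rewrite !big_seq1; apply=> p.
by rewrite inE => /eqP ->.
Qed.

(** Comparison with [1] shows that all slopes of [g] vanish, whereas a nontrivial element has a
    nonzero slope for some counting function. *)
Lemma isometric_inj_derived g : derived_subgroup g -> phi g = 1 -> g = 1.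
Proof.
move=> dg pg; apply: contrapT => /(slope_neq0 rwP x0)[w]; apply.
have g1 : conjugate (phi g) (phi 1) by rewrite pg gmulf1; exact: conjugate_refl.
by rewrite (isometric_slope1 w g1 (iffRL (ab_eq1 _) dg)) -(expg0 g) (slopeX rwP x0) mulr0.
Qed.

(** The test word has slope [m] on [d ^+ m], hence on [y]; so [y] is conjugate to a nontrivial power
    of [d], and the slope identifies the exponent as [m]. *)
Lemma isometric_primitive_power d m y : 0 < size (rw d) ->
  cyclically_reduced (rw d) -> primitive x0 (rw d) -> 0 < m ->
  conjugate (phi (d ^+ m)) (phi y) -> ab_eq (d ^+ m) y -> conjugate (d ^+ m) y.
Proof.
move=> d0 cd pd m0 cy ay.
have [w [dw yw]] := primitive_test rwP [:: y] d0 cd pd.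
have := isometric_slope1 w cy ay; rewrite (slopeX rwP x0) dw mul1r => my.
case: (yw y (mem_head _ _)) => [y0|[k k0 [cyk|cyk]]].
- by move: my; rewrite y0; lia.
- move: my; rewrite (slope_conj rwP x0 _ cyk) (slopeX rwP x0) dw mul1r => -[->]//.
- move: my; rewrite (slope_conj rwP x0 _ cyk) (slopeV rwP x0) (slopeX rwP x0) dw mul1r; lia.
Qed.

Lemma size_rwX g k : size (rw (g ^+ k)) <= k * size (rw g).
Proof.
elim: k => [|k IHk]; first by rewrite expg0 (rw1 rwP).
by rewrite expgS mulSn (leq_trans (size_rwM rwP _ _)) // leq_add2l.
Qed.

Lemma size_cyclically_reduced_conj c g : conjugate c g -> cyclically_reduced (rw c) ->
  size (rw c) <= size (rw g).
Proof.
move=> /conjugate_sym[h cE] cc; rewrite leqNgt; apply/negP => gc.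
set k := (size (rw h)).*2.+1.
have := size_rw_conj_le rwP (g ^+ k) h; rewrite -conjX -cE (rwX rwP) // size_wpow.
have := size_rwX g k; rewrite /k; nia.
Qed.

Variables (x1 x2 : G) (a1 a2 : T * bool).
Hypotheses (x1E : rw x1 = [:: a1]) (x2E : rw x2 = [:: a2]) (a12 : a1.1 != a2.1).

Lemma pow2_test p q : 0 < p -> 0 < q ->
  [/\ 0 < size (rw (x1 ^+ p * x2 ^+ q)),
      cyclically_reduced (rw (x1 ^+ p * x2 ^+ q)) &
      primitive x0 (rw (x1 ^+ p * x2 ^+ q))].
Proof.
move=> p0 q0; rewrite (rw_pow2 rwP x1E x2E a12) // size_cat !size_nseq; split.
- by rewrite addn_gt0 p0.
- exact: cyclically_reduced_pow2.
- by apply: primitive2 => //; apply: contra a12 => /eqP ->.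
Qed.

Lemma letter_test x a : rw x = [:: a] ->
  [/\ 0 < size (rw x), cyclically_reduced (rw x) & primitive x0 (rw x)].
Proof.
move=> ->; split=> //; first exact: (cyclically_reduced_nseq a 1).
exact: primitive1.
Qed.

Section Conjugating.
Variables (e : F) (p q : nat) (y1 y2 : G).
Hypotheses (p0 : 0 < p) (q0 : 0 < q).
Hypotheses (y1E : phi y1 = e * phi (x1 ^+ p) * e^-1).
Hypotheses (y2E : phi y2 = e * phi (x2 ^+ q) * e^-1).

(* For large [k] the period of the test word is longer than the cyclic length of
   the generators, so only [x1 ^+ (k * p) * x2 ^+ q] and [y1 ^+ k * y2] matter in
   the isometric relation comparing them with k[x1 ^+ p] + [x2 ^+ q]. *)
Lemma conjugate_long k : size (rw y1) + size (rw y2) + 2 <= k ->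
  conjugate ((x1 ^+ p) ^+ k * x2 ^+ q) (y1 ^+ k * y2).
Proof.
move=> hk; rewrite -expgnA.
have pk0 : 0 < p * k by rewrite muln_gt0 p0; lia.
have [d0 cd pd] := pow2_test pk0 q0.
set d := x1 ^+ (p * k) * x2 ^+ q in d0 cd pd *.
have szd : size (rw d) = (p * k + q)%N.
  by rewrite (rw_pow2 rwP x1E x2E a12) // size_cat !size_nseq.
have [w [dw lw]] :=
  primitive_test rwP [:: x1 ^+ p; x2 ^+ q; y1; y2; y1 ^+ k * y2] d0 cd pd.
have small g : g \in [:: x1 ^+ p; x2 ^+ q; y1; y2; y1 ^+ k * y2] ->
    size (rw g) < p * k + q -> slope (brooks rw w) g = 0%R.
  move=> /lw[//|[m m0 dm]] gs; exfalso; move: gs; apply/negP; rewrite -leqNgt -szd.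
  apply: (@leq_trans (m * size (rw d))); first exact: leq_pmull.
  case: dm => [dg|dg].
    have := size_cyclically_reduced_conj dg; rewrite (rwX rwP) // size_wpow; apply.
    have := reduced_wpow (m + m) cd.
    by rewrite /cyclically_reduced /wpow nseqD flatten_cat.
  have := size_cyclically_reduced_conj (conjugateV dg).
  rewrite invgK (rwX rwP) // size_wpow (rwV rwP) size_winv; apply.
  by rewrite /cyclically_reduced; have := reduced_wpow (m + m) cd; rewrite /wpow nseqD flatten_cat.
have s1 : slope (brooks rw w) (x1 ^+ p) = 0%R.
  by apply: small; rewrite ?inE ?eqxx // (rwX_letter rwP _ x1E) size_nseq; nia.
have s2 : slope (brooks rw w) (x2 ^+ q) = 0%R.
  by apply: small; rewrite ?inE ?eqxx ?orbT // (rwX_letter rwP _ x2E) size_nseq; nia.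
have s3 : slope (brooks rw w) y1 = 0%R by apply: small; rewrite ?inE ?eqxx ?orbT //; nia.
have s4 : slope (brooks rw w) y2 = 0%R by apply: small; rewrite ?inE ?eqxx ?orbT //; nia.
have ab_comm (u v : G) : ab_eq (u * v * (u^-1 * (v^-1 * 1))) 1.
  apply: (iffRL (ab_eq1 _)).
  have -> : u * v * (u^-1 * (v^-1 * 1)) = [~ u^-1, v^-1].
    by rewrite commgEl conjgE !invgK mulg1 !mulgA.
  exact: derivedR.
(* The subtracted terms enter as negative powers, so on each side the product is a commutator, and
   both sides are trivial in the abelianization. *)
pose ps := [:: (d, y1 ^+ k * y2); ((x1 ^+ p) ^- k, y1 ^- k); ((x2 ^+ q)^-1, y2^-1)].
have cps r : r \in ps -> conjugate (phi r.1) (phi r.2).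
  have ec : conjugate (phi d) (phi (y1 ^+ k * y2)).
    exists e; rewrite /d expgnA !(gmulfM, gmulfXn) y1E y2E conjM conjX.
    by rewrite !gmulfXn.
  have ec1 : conjugate (phi ((x1 ^+ p) ^- k)) (phi (y1 ^- k)).
    rewrite !gmulfV; apply: conjugateV; exists e.
    by rewrite gmulfXn y1E conjX [in RHS]gmulfXn.
  have ec2 : conjugate (phi (x2 ^+ q)^-1) (phi y2^-1).
    by rewrite !gmulfV; apply: conjugateV; exists e.
  by rewrite !inE => /orP[/eqP->|/orP[/eqP->|/eqP->]].
have aps : ab_eq (\prod_(r <- ps) r.1) (\prod_(r <- ps) r.2).
  apply: (@ab_eq_trans _ _ 1); last apply: ab_eq_sym; rewrite !big_cons !big_nil.
    by rewrite /d expgnA; exact: ab_comm.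
  exact: ab_comm.
have := isometric_slope cps aps w.
rewrite !big_cons !big_nil /= !(slopeV rwP x0) !(slopeX rwP x0 _ _ k) s1 s2 s3 s4 dw.
rewrite !mul0r !oppr0 !addr0 => h.
have inl : y1 ^+ k * y2 \in [:: x1 ^+ p; x2 ^+ q; y1; y2; y1 ^+ k * y2].
  by rewrite !inE eqxx !orbT.
case: (lw _ inl) => [h0|[m m0 [dm|dm]]]; first by rewrite h0 in h.
  move: h (dm); rewrite (slope_conj rwP x0 _ dm) (slopeX rwP x0) dw mul1r => -[<-].
  by rewrite expg1.
move: h; rewrite (slope_conj rwP x0 _ dm) (slopeV rwP x0) (slopeX rwP x0) dw mul1r; lia.
Qed.

Lemma conjugate_ab (x y : G) : conjugate x y -> ab_eq x y.
Proof. by case=> h ->; apply: ab_eq_sym; exact: ab_eqJ. Qed.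

(** Dividing the conjugacies for two consecutive exponents [k] in the abelianization identifies [y1]
    with [x1 ^+ p], and then [y2] with [x2 ^+ q]. The primitive tests for [x1], [x2] and
    [x1 ^+ p * x2 ^+ q] turn these equalities into conjugacies. *)
Lemma simultaneous_conjugate_of_isometric :
  exists g, y1 = g * x1 ^+ p * g^-1 /\ y2 = g * x2 ^+ q * g^-1.
Proof.
pose k := (size (rw y1) + size (rw y2) + 2)%N.
have ck := conjugate_ab (@conjugate_long k (leqnn _)).
have ck1 := conjugate_ab (@conjugate_long k.+1 (leqnSn _)).
have a1E : ab_eq (x1 ^+ p) y1.
  have := ab_eqM ck1 (ab_eqV ck); rewrite !expgS -!mulgA.
  by rewrite !(mulgA ((x1 ^+ p) ^+ k)) !(mulgA (y1 ^+ k)) !mulgV !mulg1.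
have a2E : ab_eq (x2 ^+ q) y2.
  have ak : ab_eq ((x1 ^+ p) ^+ k) (y1 ^+ k).
    elim: (k) => [|j IHj]; first by rewrite !expg0; exact: ab_eq_refl.
    by rewrite !expgS; exact: ab_eqM.
  by have := ab_eqM (ab_eqV ak) ck; rewrite !mulgA !mulVg !mul1g.
apply: (simultaneous_conjugate rwP x1E x2E a12) => //.
- have [d0 cd pd] := letter_test x1E.
  by apply: isometric_primitive_power => //; exists e.
- have [d0 cd pd] := letter_test x2E.
  by apply: isometric_primitive_power => //; exists e.
- have [d0 cd pd] := pow2_test p0 q0.
  rewrite -[X in conjugate X _]expg1; apply: isometric_primitive_power => //.
    by rewrite expg1; exists e; rewrite !gmulfM y1E y2E conjM.
  by rewrite expg1; exact: ab_eqM.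
Qed.

End Conjugating.
End Isometric.

(** * Finite index and self-commensuration *)

Lemma finite_index_power (F : groupType) (A E : set F) (y : F) :
  is_subgroup A -> is_subgroup E -> finite_index A E -> E y ->
  exists2 j, 0 < j & A (y ^+ j).
Proof.
move=> [A1 AM AV] [E1 EM EV] fAE Ey.
have Ek k : E (y ^+ k) by elim: k => [|k IHk]; rewrite ?expg0 // expgS; exact: EM.
pose f k := left_coset (y ^+ k) A.
(* Pigeonhole: infinitely many powers of [y] are spread over finitely many left cosets of [A]. *)
suff [i [j [ij fij]]] : exists i j, i < j /\ f i = f j.
  exists (j - i)%N; first by rewrite subn_gt0.
  have : f j (y ^+ j) by exists 1; rewrite ?mulg1.
  rewrite -fij => -[a Aa]; rewrite -{1}(subnKC (ltnW ij)) expgnDr => /mulgI <-.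
  exact: Aa.
apply: contrapT => nij; apply: infinite_nat.
have -> : [set: nat] = f @^-1` [set left_coset x A | x in E].
  by apply/seteqP; split=> // k _; exists (y ^+ k).
apply: finite_preimage fAE => i j _ _ fij.
have [lt|lt|//] := ltngtP i j; exfalso; apply: nij; first by exists i, j.
by exists j, i.
Qed.

Lemma image_is_subgroup (G F : groupType) (phi : group_hom G F) :
  is_subgroup [set phi g | g in [set: G]].
Proof.
split=> [|_ _ [g _ <-] [h _ <-]|_ [g _ <-]]; first by exists 1; rewrite ?gmulf1.
- by exists (g * h); rewrite ?gmulfM.
- by exists g^-1; rewrite ?gmulfV.
Qed.

Lemma fg_image (G F : groupType) (n : nat) (x : 'I_n -> G) (phi : group_hom G F) :
  free_basis x -> fg_subgroup [set phi g | g in [set: G]].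
Proof.
move=> fx; exists [set phi (x i) | i in [set: 'I_n]].
  by apply: finite_image; exact: finite_finset.
apply/seteqP; split; last first.
  apply: subgroup_generatedS; first exact: image_is_subgroup.
  by move=> _ [i _ <-]; exists (x i).
move=> _ [g _ <-] A [[A1 AM AV] xA].
apply: (free_basis_generates fx (A := [set h | A (phi h)])) => [|i].
  split=> [|h k Ah Ak|h Ah] /=; first by rewrite gmulf1.
  - by rewrite gmulfM; exact: AM.
  - by rewrite gmulfV; exact: AV.
by apply: xA; exists i.
Qed.

Lemma fg_subgroup_is_subgroup (F : groupType) (E : set F) : fg_subgroup E -> is_subgroup E.
Proof.
case=> S _ ->; split=> [A [[]]//|g h Sg Sh A SA|g Sg A SA]; case: (SA) => -[A1 AM AV] _.
- by apply: AM; [exact: Sg|exact: Sh].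
- by apply: AV; exact: Sg.
Qed.

Theorem proposition2p9 (R : realType) (G F : groupType) (n m : nat)
  (hG : free_of_rank G n) (hF : free_of_rank F m) (hn : n <> 1%N)
  (phi : group_hom G F) (hphi : isometric R phi) :
  self_commensurating [set phi g | g in [set: G]].
Proof.
case: hG => x fx; case: hF => z fz; split; first exact: fg_image fx.
case=> E [/fg_subgroup_is_subgroup sE [AE nEA] fAE]; set A := [set phi g | g in _] in AE nEA fAE.
have sA : is_subgroup A by exact: image_is_subgroup.
have [rwF rwFP _] := free_basis_coordinates fz.
apply: nEA => e Ee.
have powA y : E y -> exists2 j, 0 < j & A (y ^+ j).
  by move=> Ey; exact: finite_index_power fAE Ey.
(* In rank 0 the image is trivial, so some positive power of [e] is 1 and torsion-freeness gives
   [e = 1]. Rank 1 is excluded by [hn], and from rank 2 on two distinct basis letters are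
   available. *)
case: n hn x fx => [_ x fx|[//|n] _ x fx].
  have G1 : forall g : G, [set 1] g.
    apply: (free_basis_generates fx) => [|[]//].
    by split=> // [_ _ -> ->|_ ->] /=; rewrite ?mulg1 ?invg1.
  have [j j0 [g _]] := powA e Ee; rewrite (G1 g) gmulf1 => /esym ej.
  by rewrite (torsion_free rwFP ej j0); exists 1; rewrite ?gmulf1.
have [rw rwP rwx] := free_basis_coordinates fx.
pose i1 : 'I_n.+2 := ord0; pose i2 : 'I_n.+2 := ord_max.
have i12 : (i1, false).1 != (i2, false).1 by [].
(* The conjugate of [phi g] by [e] lies in [E], so by finite index one of its positive powers is in
   the image. *)
have conjA g : exists2 j, 0 < j & exists y, phi y = e * phi (g ^+ j) * e^-1.
  case: (sE) => E1 EM EV.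
  have [|j j0 [y _ yE]] := powA (e * phi g * e^-1).
    by apply: (EM); [apply: EM => //; apply: AE; exists g|exact: EV].
  by exists j => //; exists y; rewrite yE conjX gmulfXn.
have [p p0 [y1 y1E]] := conjA (x i1); have [q q0 [y2 y2E]] := conjA (x i2).
have [g [g1 g2]] := simultaneous_conjugate_of_isometric hphi (i1, false) rwP
  (rwx i1) (rwx i2) i12 p0 q0 y1E y2E.
(* Corrected by [phi g], the element [e] still lies in [E] and now commutes with the images of
   [x i1 ^+ p] and [x i2 ^+ q]. *)
pose e' := (phi g)^-1 * e.
have comm h y : phi y = e * phi h * e^-1 -> y = g * h * g^-1 -> commute e' (phi h).
  move=> yE gE; rewrite gE !gmulfM gmulfV in yE.
  rewrite /commute /e'; apply: (mulgI (phi g)); apply: (mulIg e^-1).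
  rewrite !mulgA mulgV mul1g -yE.
  by rewrite -!mulgA mulgV mulg1.
have Ee' : E e'.
  by case: sE => _ EM EV; apply: EM => //; apply: EV; apply: AE; exists g.
have [j j0 [z' _ zE]] := powA e' Ee'.
(* The commutator of [z'] and [h] has trivial image, and [phi] has no kernel in the derived
   subgroup, so commutation lifts to [G]. *)
have zcomm h y : phi y = e * phi h * e^-1 -> y = g * h * g^-1 -> commute z' h.
  move=> yE gE; apply/commgP/eqP.
  apply: (isometric_inj_derived hphi (i1, false) rwP); first exact: derivedR.
  rewrite gmulfR; apply/eqP/commgP; rewrite zE; apply/commute_sym/commuteX/commute_sym.
  exact: comm yE gE.
have z1 : z' = 1.
  exact: (commute_pow_eq1 rwP (rwx i1) (rwx i2) i12 p0 q0 (zcomm _ _ y1E g1) (zcomm _ _ y2E g2)).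
have e'1 : e' = 1.
  by apply: (torsion_free rwFP (k := j)) => //; rewrite -zE z1 gmulf1.
exists g => //; apply: (mulgI (phi g)^-1).
by rewrite mulVg -[LHS]e'1.
Qed.
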